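(* Let $\Gamma$ be a graph of rank $n\geq2$, $K=(2^n-1)(2^{2n-1}-1)$ and $A=3(K+1)$. For every $\ell\in\Sigma_\Gamma$ and $\tau\in T_\ell\Sigma_\Gamma$, $$\|(\ell,\tau)\|^N\leq A\,\|(\ell,-\tau)\|^N.$$
   Context: A graph is a finite connected cell complex of dimension 1 with all vertices of valence $>2$. A metric on $\Gamma$ is a function $\ell:E(\Gamma)\to[0,1]$ with $\sum_e\ell(e)=1$ and such that $\bigcup_{\ell(e)=0}e$ is a forest; $\Sigma_\Gamma$ is the space of all metrics on $\Gamma$, and $T_\ell\Sigma_\Gamma=\{\tau:E(\Gamma)\to\mathbb{R}\mid\sum_e\tau(e)=0\}$. Loops are essential. For a loop $\alpha$, $\ell(\alpha)$ (resp. $\tau(\alpha)$) is the sum of $\ell(e)$ (resp. $\tau(e)$) over the edges crossed, with multiplicity, by the immersed loop freely homotopic to $\alpha$. Define $$\|(\ell,\tau)\|^L=\sup\{\tau(\alpha)/\ell(\alpha)\mid\alpha\text{ a loop in }\Gamma\}.$$ Let $\Gamma_i\to\Gamma$, $i=1,\dots,2^n-1$, be all nontrivial (connected) double covers of $\Gamma$ (each of rank $2n-1$), and let $\ell_i$, $\tau_i$ be the pullbacks of $\ell,\tau$ to $\Gamma_i$ (each edge gets the value of its image, with no renormalization). For $a\in H_1(\Gamma_i;\mathbb{Z}_2)\setminus\{0\}$ let $\ell_i(a)$ be the minimal $\ell_i$-length of a loop in $\Gamma_i$ representing $a$; a loop $\alpha$ representing $a$ realizes $\ell_i(a)$ if $\ell_i(\alpha)=\ell_i(a)$.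 Define $$N(\ell,\tau)=-\sum_{\Gamma_i}\ \sum_{a\in H_1(\Gamma_i;\mathbb{Z}_2)\setminus\{0\}}\frac{\max\{\tau_i(\alpha)\mid\alpha\text{ a loop in }\Gamma_i\text{ realizing }\ell_i(a)\}}{\ell_i(a)},$$ a sum with $K$ terms, and $$\|(\ell,\tau)\|^N=\|(\ell,\tau)\|^L+\frac1{K+1}N(\ell,\tau).$$ *)

(* Defs.v *)
From mathcomp Require Import all_boot all_order all_algebra.
From mathcomp Require Import all_classical all_reals.
Set Implicit Arguments.
Unset Strict Implicit.
Unset Printing Implicit Defensive.
Import Order.TTheory GRing.Theory Num.Theory.
Local Open Scope classical_set_scope.
Local Open Scope ring_scope.

(* A finite cell complex of dimension at most 1, each 1-cell carrying an
   arbitrary orientation; multiple edges and edges with [src e = tgt e] are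
   allowed. *)
Record complex1 : Type := Complex1 {
  vert : finType;
  edge : finType;
  src : edge -> vert;
  tgt : edge -> vert }.

(* Oriented edges: [(e, false)] runs from [src e] to [tgt e] and [(e, true)]
   is [e] traversed backwards. *)
Notation dart G := (edge G * bool)%type.

Definition org (G : complex1) (d : dart G) : vert G :=
  if d.2 then tgt d.1 else src d.1.

Definition end_ (G : complex1) (d : dart G) : vert G :=
  if d.2 then src d.1 else tgt d.1.

Definition flip (G : complex1) (d : dart G) : dart G := (d.1, ~~ d.2).

Definition adj (G : complex1) : rel (vert G) :=
  fun u v => [exists d : dart G, (org d == u) && (end_ d == v)].

Definition connected (G : complex1) : Prop :=
  (0 < #|vert G|)%N /\ forall u v : vert G, connect (@adj G) u v.

(* An edge with both ends at [v] contributes 2. *)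
Definition valence (G : complex1) (v : vert G) : nat :=
  #|[set d : dart G | org d == v]%SET|.

Definition is_graph (G : complex1) : Prop :=
  connected G /\ forall v : vert G, (2 < valence v)%N.

(* The cellular boundary map C_1 -> C_0 with coefficients in F, acting on row
   vectors. There are no 2-cells, so H_1 is its kernel. *)
Definition boundary (F : fieldType) (G : complex1) :
    'M[F]_(#|edge G|, #|vert G|) :=
  \matrix_(i, j) ((tgt (enum_val i) == enum_val j)%:R -
                  (src (enum_val i) == enum_val j)%:R).

(* The rank of the free group pi_1(G), G connected, is that of its
   abelianization, namely dim H_1(G; Q). *)
Definition graph_rank (G : complex1) : nat := \rank (kermx (boundary rat G)).

Definition H1_2 (G : complex1) : {set 'rV['F_2]_#|edge G|} :=
  [set a | a *m boundary 'F_2 G == 0]%SET.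

(* Closed edge paths; the base point is irrelevant, and the empty sequence
   stands for the constant loops. *)
Definition closed_path (G : complex1) (p : seq (dart G)) : bool :=
  cycle (fun d d' => end_ d == org d') p.

(* Cancels all backtracks [d; flip d]. *)
Fixpoint reduce (G : complex1) (p : seq (dart G)) : seq (dart G) :=
  if p is d :: p' then
    let r := reduce p' in
    if r is d' :: r' then (if d' == flip d then r' else d :: r) else [:: d]
  else [::].

(* Removes the first and last darts as long as they are inverse to each other;
   [k] is fuel, [size p] being always enough. *)
Fixpoint trim (G : complex1) (k : nat) (p : seq (dart G)) : seq (dart G) :=
  if k is k'.+1 then
    if p is d :: p' then
      if last d p' == flip d then trim k' (behead (belast d p')) else p
    else [::]
  else p.

(* The immersed (i.e. cyclically reduced) closed path freely homotopic to [p],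
   which is unique up to rotation; it is empty iff [p] is null-homotopic. *)
Definition tighten (G : complex1) (p : seq (dart G)) : seq (dart G) :=
  let r := reduce p in trim (size r) r.

Definition is_loop (G : complex1) (p : seq (dart G)) : Prop :=
  closed_path p /\ tighten p <> [::].

(* l(alpha), tau(alpha) *)
Definition value (R : realType) (G : complex1) (f : edge G -> R)
    (p : seq (dart G)) : R :=
  \sum_(d <- tighten p) f d.1.

(* Orientations do not matter modulo 2. *)
Definition hclass (G : complex1) (p : seq (dart G)) : 'rV['F_2]_#|edge G| :=
  \row_i (count (fun d => d.1 == enum_val i) p)%:R.

(* All components of the subcomplex spanned by the edges in [F] are trees,
   i.e. simply connected. *)
Definition forest (G : complex1) (F : pred (edge G)) : Prop :=
  forall p : seq (dart G), is_loop p -> ~~ all (fun d => F d.1) p.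

Definition is_metric (R : realType) (G : complex1) (l : edge G -> R) : Prop :=
  [/\ forall e, 0 <= l e <= 1,
      \sum_e l e = 1
    & forest [pred e | l e == 0]].

Definition is_tangent (R : realType) (G : complex1) (tau : edge G -> R) : Prop :=
  \sum_e tau e = 0.

Definition normL (R : realType) (G : complex1) (l tau : edge G -> R) : R :=
  sup [set value tau p / value l p | p in @is_loop G].

(* The cells of a covering space carry the lifted orientations. *)
Record double_cover (G : complex1) : Type := DoubleCover {
  total :> complex1;
  pvert : vert total -> vert G;
  pedge : edge total -> edge G;
  pvert_src : forall e, pvert (src e) = src (pedge e);
  pvert_tgt : forall e, pvert (tgt e) = tgt (pedge e);
  fibre2 : forall v : vert G, #|[set w | pvert w == v]%SET| = 2%N;
  star_lift : forall (w : vert total) (d : dart G), org d = pvert w ->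
    exists! d' : dart total, org d' = w /\ (pedge d'.1, d'.2) = d }.

Definition cover_iso (G : complex1) (C D : double_cover G) : Prop :=
  exists (fv : vert C -> vert D) (fe : edge C -> edge D),
    [/\ bijective fv, bijective fe,
        forall e, fv (src e) = src (fe e) /\ fv (tgt e) = tgt (fe e),
        forall w, pvert (fv w) = pvert w
      & forall e, pedge (fe e) = pedge e].

(* [C] lists all connected double covers of [G], each exactly once up to
   isomorphism over [G]. *)
Definition all_double_covers (G : complex1) (I : finType)
    (C : I -> double_cover G) : Prop :=
  (forall i, connected (C i)) /\
  forall D : double_cover G, connected D -> exists! i : I, cover_iso (C i) D.

Definition pullback (R : realType) (G : complex1) (C : double_cover G)
    (f : edge G -> R) : edge C -> R := fun e => f (pedge e).

Definition represents (G : complex1) (a : 'rV['F_2]_#|edge G|) :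
    set (seq (dart G)) := [set p | is_loop p /\ hclass p = a].

(* The infimum is attained if [l] is (a pullback of) a metric, [G] is connected
   and [a] is a nonzero class. *)
Definition min_length (R : realType) (G : complex1) (l : edge G -> R)
    (a : 'rV['F_2]_#|edge G|) : R :=
  inf [set value l p | p in represents a].

Definition realizes (R : realType) (G : complex1) (l : edge G -> R)
    (a : 'rV['F_2]_#|edge G|) : set (seq (dart G)) :=
  [set p | represents a p /\ value l p = min_length l a].

(* Under the same conditions only finitely many immersed loops realize
   [min_length l a], so that this supremum is a maximum. *)
Definition max_realizing (R : realType) (G : complex1) (l tau : edge G -> R)
    (a : 'rV['F_2]_#|edge G|) : R :=
  sup [set value tau p | p in realizes l a].

Definition Nsum (R : realType) (G : complex1) (I : finType)
    (C : I -> double_cover G) (l tau : edge G -> R) : R :=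
  - \sum_(i : I) \sum_(a in H1_2 (C i) | a != 0)
      max_realizing (pullback (C := C i) l) (pullback (C := C i) tau) a
      / min_length (pullback (C := C i) l) a.

Definition normN (R : realType) (G : complex1) (I : finType)
    (C : I -> double_cover G) (K : nat) (l tau : edge G -> R) : R :=
  normL l tau + (K.+1%:R)^-1 * Nsum C l tau.

(* Main.v *)
Require Import Defs.
From mathcomp Require Import all_boot all_order all_algebra.
From mathcomp Require Import all_classical all_reals.
From mathcomp Require Import ring lra zify.
Set Implicit Arguments.
Unset Strict Implicit.
Unset Printing Implicit Defensive.
Import Order.TTheory GRing.Theory Num.Theory.
Local Open Scope ring_scope.

(** Write [L] and [L'] for the Lipschitz norms of [tau] and [- tau], and [M] for
    the number of terms of the correction [N].

    Every term of the correction is bounded by the values of [tau / l] on loops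
    of covers, hence on loops of [G]. So [N (tau) <= M * L'] and
    [N (- tau) >= - (M * L')]. The asymmetry can only be bad when [L] is much
    larger than [L'], and then [N (- tau)] has to contain a term that is
    comparable to [L]. All other terms being at least [- L'], the number
    [c := N (- tau) + M * L'] is nonnegative and bounds [L'] plus any single
    term. The heart of the matter is the inequality [L <= 3 * c - L']. With
    [M <= K] the theorem follows by arithmetic; that [M] is at most [K] is a
    count of double covers (cocycles modulo coboundaries, [count_covers]) and of
    homology classes ([count_classes]).

    Which terms are available? Collapse the forest of the edges of length zero,
    and consider cyclic words in the remaining edges: by uniqueness of reduced
    paths in a forest they are the same as immersed loops ([collapse_tight],
    [expand_cycle]). If a word visits each vertex of the collapsed graph at most
    twice, put its first visits on one sheet and its second visits on the other.
    This defines a connected double cover in which the word lifts to one that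
    visits each vertex at most once ([adapted_cover], [lift_word]). The homology
    class of such a simple word determines the edges of positive length of its
    shortest loops, and these edges can be traversed in one way only. So all loops
    that realize the class have the same value ([simple_word]), and the
    corresponding term of [N (- tau)] is the ratio [tau / l] of the word
    ([good_class]). Hence [tau' := tau + L' * l] is at most [c * l] on every
    word that visits no vertex three times.

    It remains to pass from these words to all words, at the expense of a factor
    3 ([thrice_le]). Here it matters that [tau'] is nonnegative on all loops: as
    there is no negative cycle, a potential makes the weight of every turn
    nonnegative ([exists_potential]). So it suffices to cover the turns of a
    given word by words of the special kind, with total length at most three times
    its length. Repeat the given word infinitely often and proceed greedily from
    one simple cycle of the walk to the next. Turns on overlapping simple cycles
    are covered by these cycles themselves. Two consecutive cycles without overlap
    are completed by the path between them, run back and forth, to a barbell,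
    which visits each vertex at most twice.

    The argument uses [L' >= 0]. As each vertex has valence at least two, the
    darts of [G] can be joined into immersed closed paths which together cross
    each edge exactly twice; summing [tau'] over them gives twice [L'], because
    [tau] has sum zero and [l] has sum one ([L'_ge0]). *)

(** * Tight paths *)

Section TightPaths.
Variable G : complex1.
Implicit Types (d : dart G) (p q : seq (dart G)) (u v : vert G).

Fixpoint walk u p v : bool :=
  if p is d :: p' then (org d == u) && walk (end_ d) p' v else u == v.

Definition noback p : bool := sorted (fun d d' => d' != flip d) p.

Definition turn : rel (dart G) :=
  fun d d' => (end_ d == org d') && (d' != flip d).

(** The immersed closed paths, which are the values of [tighten]. *)
Definition tight q : bool := cycle turn q.

Definition rpath p := rev (map (@flip G) p).

Lemma flipK : involutive (@flip G).
Proof. by case=> e b; rewrite /flip /= negbK. Qed.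

Lemma flip_neq d : flip d != d.
Proof. by case: d => e b; rewrite /flip xpair_eqE eqxx /=; case: b. Qed.

Lemma flip_eq d d' : (flip d == d') = (d == flip d').
Proof. by apply/eqP/eqP => [<-|->]; rewrite flipK. Qed.

Lemma org_flip d : org (flip d) = end_ d.
Proof. by case: d => e []. Qed.

Lemma end_flip d : end_ (flip d) = org d.
Proof. by case: d => e []. Qed.

Lemma turn_flip d d' : turn (flip d') (flip d) = turn d d'.
Proof.
rewrite /turn end_flip org_flip flipK eq_sym; congr (_ && _).
by rewrite eq_sym.
Qed.

Lemma rpath_cons d p : rpath (d :: p) = rcons (rpath p) (flip d).
Proof. by rewrite /rpath /= rev_cons. Qed.

Lemma walk_cat u p v q w : walk u p v -> walk v q w -> walk u (p ++ q) w.
Proof.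
by elim: p u => [|d p IH] u /= => [/eqP->//|/andP[-> wp] wq]; apply: IH.
Qed.

Lemma walk_rcons u p d v :
  walk u (rcons p d) v = walk u p (org d) && (end_ d == v).
Proof.
elim: p u => [|d' p IH] u /=; first by rewrite eq_sym.
by rewrite IH andbA.
Qed.

Lemma walk_rpath u p v : walk u p v -> walk v (rpath p) u.
Proof.
elim: p u => [|d p IH] u /=; first by rewrite eq_sym.
case/andP=> /eqP<- wp; rewrite rpath_cons walk_rcons org_flip end_flip eqxx.
by rewrite IH.
Qed.

Lemma walk_path u d s v :
  walk u (d :: s) v && noback (d :: s) =
  [&& org d == u, path turn d s & end_ (last d s) == v].
Proof.
elim: s u d => [|d' s IH] u d /=; first by rewrite !andbT.
apply/idP/idP.
  case/andP=> /andP[ou w'] /andP[nd nb'].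
  have: walk (end_ d) (d' :: s) v && noback (d' :: s) by apply/andP.
  rewrite IH => /and3P[oe pt en]; apply/and3P; split=> //.
  by rewrite /= /turn eq_sym oe nd.
case/and3P=> ou /andP[/andP[oe nd] pt] en.
have := IH (end_ d) d'; rewrite eq_sym oe pt en => /andP[w' nb'].
by apply/andP; split; apply/andP; split=> //; case/andP: w'.
Qed.

Lemma closed_path_walk d s : closed_path (d :: s) = walk (org d) (d :: s) (org d).
Proof.
rewrite /closed_path /= eqxx /=; move: {2 4}d => d0.
by elim: s d => [|d' s IH] d /=; [rewrite andbT | rewrite IH eq_sym].
Qed.

Lemma reduce_walk u p v : walk u p v -> walk u (reduce p) v.
Proof.
elim: p u => //= d p IH u /andP[/eqP ou /IH].
case: (reduce p) => [|d' r] /=; first by rewrite ou eqxx.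
case: (d' =P flip d) => [->|_] /=; last by rewrite ou eqxx.
by rewrite end_flip ou => /andP[_].
Qed.

Lemma reduce_noback p : noback (reduce p).
Proof.
elim: p => //= d p; case: (reduce p) => [|d' r] //=.
case: (d' =P flip d) => [_|/eqP nd] /=; first exact: path_sorted.
by rewrite nd.
Qed.

Lemma reduce_id p : noback p -> reduce p = p.
Proof.
elim: p => //= d p IH; case: p IH => [|d' p] //= IH /andP[nd /IH ->].
by rewrite (negbTE nd).
Qed.

Lemma all_reduce (a : pred (dart G)) p : all a p -> all a (reduce p).
Proof.
elim: p => //= d p IH /andP[ad /IH]; case: (reduce p) => [|d' r] /=.
  by rewrite ad.
by case: ifP => _ /andP[ad' ar] //=; rewrite ad ad' ar.
Qed.

Lemma trim_rcons k d m e :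
  trim k.+1 (d :: rcons m e) = if e == flip d then trim k m else d :: rcons m e.
Proof. by rewrite /= last_rcons belast_rcons. Qed.

Lemma noback_inner d m e : noback (d :: rcons m e) -> noback m.
Proof.
rewrite /noback /= => /path_sorted.
by case: m => //= x t; rewrite rcons_path => /andP[].
Qed.

Lemma trim_neq0 k p : noback p -> p <> [::] -> trim k p <> [::].
Proof.
elim: k p => // k IH p; case: p => // d s; case/lastP: s => [|m e] nb _.
  by rewrite /= eq_sym (negbTE (flip_neq d)).
rewrite trim_rcons; case: eqP => // ed; apply: IH; first exact: noback_inner nb.
by move=> m0; move: nb; rewrite m0 ed /= eqxx.
Qed.

Lemma tight_cons d s :
  tight (d :: s) = path turn d s && turn (last d s) d.
Proof. by rewrite /tight /= rcons_path. Qed.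

Lemma trim_tight k p u : (size p <= k)%N -> walk u p u -> noback p ->
  tight (trim k p).
Proof.
elim: k p u => [|k IH] p u; first by case: p.
case: p => // d s; case/lastP: s => [|m e] szk wp nb.
  rewrite /= [d == _]eq_sym (negbTE (flip_neq d)) /tight /= /turn.
  rewrite [d == _]eq_sym flip_neq.
  by move: wp => /= /andP[/eqP-> /eqP->]; rewrite eqxx.
rewrite trim_rcons; case: eqP => [ed|/eqP ned].
  move: wp; rewrite /= walk_rcons ed end_flip org_flip.
  case/and3P=> _ wm _; apply: (IH _ (end_ d)) => //; last exact: noback_inner nb.
  by move: szk; rewrite /= size_rcons => /ltnW.
rewrite tight_cons last_rcons.
have := walk_path u d (rcons m e) u; rewrite wp nb.
case/esym/and3P=> /eqP ou -> /eqP; rewrite last_rcons => eu.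
by rewrite /turn ou eu eqxx /= -flip_eq eq_sym.
Qed.

Lemma tight_closed q : tight q -> closed_path q.
Proof. by apply: sub_cycle => d d' /andP[]. Qed.

Lemma tight_noback q : tight q -> noback q.
Proof.
case: q => // d s; rewrite tight_cons => /andP[+ _].
by apply: sub_path => x y /andP[].
Qed.

Lemma tight_tighten p : closed_path p -> tight (tighten p).
Proof.
case: p => // d s; rewrite closed_path_walk => wp.
by apply: trim_tight (reduce_walk wp) (reduce_noback _).
Qed.

Lemma tighten_tight q : tight q -> tighten q = q.
Proof.
move=> tq; rewrite /tighten reduce_id; last exact: tight_noback.
case: q tq => // d s; rewrite tight_cons => /andP[_ /andP[_ nd]] /=.
by rewrite ifN // -flip_eq eq_sym.
Qed.

Lemma tight_is_loop q : tight q -> q <> [::] -> is_loop q.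
Proof. by move=> tq q0; split; [exact: tight_closed | rewrite tighten_tight]. Qed.

Lemma tight_rpath q : tight (rpath q) = tight q.
Proof.
by rewrite /tight /rpath rev_cycle cycle_map; apply: eq_cycle => d d' /=; rewrite turn_flip.
Qed.

Lemma all_tighten (a : pred (dart G)) p : all a p -> all a (tighten p).
Proof.
move/all_reduce; rewrite /tighten; move: (reduce p) (size _) => r k.
elim: k r => // k IH r; case: r => // d s; case/lastP: s => [|m e].
  by rewrite /= eq_sym (negbTE (flip_neq d)).
by rewrite trim_rcons; case: ifP => // _ /= /andP[_]; rewrite all_rcons => /andP[_ /IH].
Qed.

(** Cancelling a backtrack does not change the number of crossings of an edge
    modulo 2. *)
Lemma odd_count_reduce (a : pred (edge G)) p :
  odd (count (fun d => a d.1) (reduce p)) = odd (count (fun d => a d.1) p).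
Proof.
elim: p => //= d p; rewrite oddD => <-.
case: (reduce p) => [|d' r] /=; first by rewrite oddD.
case: (d' =P flip d) => [->|_] /=; last by rewrite !oddD.
by rewrite oddD addbA addbb.
Qed.

Lemma odd_count_trim (a : pred (edge G)) k p :
  odd (count (fun d => a d.1) (trim k p)) = odd (count (fun d => a d.1) p).
Proof.
elim: k p => // k IH p; case: p => // d s; case/lastP: s => [|m e].
  by rewrite /= eq_sym (negbTE (flip_neq d)).
rewrite trim_rcons; case: eqP => // ->; rewrite IH /= -cats1 count_cat /=.
by rewrite addn0 addnCA addnn oddD odd_double addbF.
Qed.

Lemma odd_count_tighten (a : pred (edge G)) p :
  odd (count (fun d => a d.1) (tighten p)) = odd (count (fun d => a d.1) p).
Proof. by rewrite /tighten odd_count_trim odd_count_reduce. Qed.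

(** * Walks in a forest *)

Section Forest.
Variable F : pred (edge G).
Hypothesis forestF : forest F.
Let inF p := all (fun d : dart G => F d.1) p.

(** Trimming a reduced closed walk stops before the walk is exhausted, because
    the two middle darts are not inverse to each other; so a nonempty one would
    be an essential loop. *)
Lemma forest_closed u p : walk u p u -> noback p -> inF p -> p = [::].
Proof.
move=> wp nb Fp; apply/eqP; apply: contraT => /eqP p0.
suff /forestF: is_loop p by rewrite -/(inF p) Fp.
case: p wp nb p0 {Fp} => // d s wp nb _; split.
  have ou : org d = u by case/andP: wp => /eqP.
  by rewrite closed_path_walk ou.
by rewrite /tighten reduce_id //; apply: trim_neq0.
Qed.

Lemma inF_rpath p : inF (rpath p) = inF p.
Proof. by rewrite /inF /rpath all_rev all_map. Qed.

Lemma noback_rpath p : noback (rpath p) = noback p.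
Proof.
rewrite /noback /rpath rev_sorted sorted_map; apply: eq_sorted => d d' /=.
by rewrite flipK eq_sym.
Qed.

(** Two different reduced walks with the same ends would combine, after their
    common beginning, into a nonempty reduced closed walk. *)
Lemma forest_walk_uniq u v p q : walk u p v -> walk u q v ->
  noback p -> noback q -> inF p -> inF q -> p = q.
Proof.
elim: p q u => [|d p IH] [|d' q] u wp wq nbp nbq Fp Fq //.
- by move: wp => /= /eqP e; apply/esym/(@forest_closed u) => //; rewrite {2}e.
- by move: wq => /= /eqP e; apply/(@forest_closed u) => //; rewrite {2}e.
have [dd'|ndd'] := eqVneq d d'.
  rewrite -dd' in wq *; congr cons; apply: (IH _ (end_ d)).
  - by case/andP: wp.
  - by case/andP: wq.
  - exact: path_sorted nbp.
  - exact: path_sorted nbq.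
  - by case/andP: Fp.
  - by case/andP: Fq.
have: rpath (d :: p) ++ d' :: q = [::].
  apply: (@forest_closed v).
  - exact: walk_cat (walk_rpath wp) wq.
  - rewrite rpath_cons /noback cat_rcons.
    have := nbp; rewrite -noback_rpath rpath_cons /noback -cats1 => h1.
    rewrite /noback sorted_cat_cons -cats1 h1 /=; move: nbq; rewrite /noback /= => ->.
    by rewrite flipK eq_sym ndd'.
  - by rewrite /inF all_cat -/(inF _) inF_rpath Fp.
by rewrite rpath_cons -cats1 -catA /=; case: (rpath p).
Qed.

End Forest.
End TightPaths.

Arguments turn {G}.

(** * Collapsing a forest *)

Section CyclicSum.
Variables (R : realType) (T : Type).
Implicit Types (k : T -> T -> R) (x y : T) (s : seq T).

Fixpoint psum k x s : R := if s is y :: s' then k x y + psum k y s' else 0.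

(** Words are valued by cyclic sums over their turns: in a collapsed graph a
    turn carries the weight of the path through the forest that it stands for. *)
Definition csum k s : R := if s is x :: s' then psum k x (rcons s' x) else 0.

Lemma psum_cat k x s t : psum k x (s ++ t) = psum k x s + psum k (last x s) t.
Proof. by elim: s x => [|y s IH] x /=; rewrite ?add0r // IH addrA. Qed.

Lemma psum_rcons k x s y : psum k x (rcons s y) = psum k x s + k (last x s) y.
Proof. by rewrite -cats1 psum_cat /= addr0. Qed.

Lemma csum_cons k x s : csum k (x :: s) = psum k x s + k (last x s) x.
Proof. by rewrite /csum psum_rcons. Qed.

(** Potentials telescope around a cycle. *)
Lemma csum_potential k (pi : T -> R) s :
  csum (fun x y => k x y + pi x - pi y) s = csum k s.
Proof.
case: s => // x s; rewrite /csum.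
have E t z : psum (fun x y => k x y + pi x - pi y) z t =
             psum k z t + pi z - pi (last z t).
  elim: t z => [|y t IH] z /=; first by rewrite add0r subrr.
  by rewrite IH; ring.
by rewrite E last_rcons addrK.
Qed.

End CyclicSum.

Lemma csum_map (R : realType) (T U : Type) (e : rel T) (p : T -> U)
    (k : T -> T -> R) (k' : U -> U -> R) s :
  (forall x y, e x y -> k x y = k' (p x) (p y)) -> cycle e s ->
  csum k s = csum k' (map p s).
Proof.
move=> kk; case: s => //= x s; rewrite -map_rcons; move: (rcons s x) => t.
by elim: t x => //= y t IH x /andP[/kk-> /IH->].
Qed.

Lemma cycle_nthP (T : Type) (e : rel T) x0 (s : seq T) :
  reflect (forall i, (i < size s)%N -> e (nth x0 s i) (nth x0 s (i.+1 %% size s)))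
          (cycle e s).
Proof.
case: s => [|x s]; first by apply: (iffP idP).
have nthE i : (i < (size s).+1)%N ->
    nth x0 (x :: s) (i.+1 %% (size s).+1) = nth x0 (rcons s x) i.
  rewrite ltnS leq_eqVlt => /orP[/eqP ->|i_s].
    by rewrite modnn nth_rcons ltnn eqxx.
  by rewrite modn_small // nth_rcons i_s.
apply: (iffP (pathP x0)) => H i i_s.
  have := H i; rewrite size_rcons -rcons_cons nth_rcons i_s => /(_ isT).
  by rewrite nthE.
rewrite size_rcons in i_s; rewrite -rcons_cons nth_rcons [size (x :: s)]/= i_s.
by rewrite -nthE //; apply: H.
Qed.

Section Collapse.
Variables (R : realType) (G : complex1) (F : pred (edge G)).
Hypothesis forestF : forest F.
Implicit Types (d : dart G) (p q s : seq (dart G)) (u v : vert G).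
Implicit Types (f : edge G -> R).

Definition inF s := all (fun d : dart G => F d.1) s.
Definition pos d := ~~ F d.1.

Definition adjF : rel (vert G) :=
  fun u v => [exists d : dart G, [&& F d.1, org d == u & end_ d == v]].

(** The component of a vertex in the forest, given by a representative: these
    are the vertices of the graph obtained by collapsing the forest. *)
Definition cc u : vert G := fingraph.root adjF u.

Lemma adjF_sym : symmetric adjF.
Proof.
move=> u v; apply/existsP/existsP => -[d /and3P[Fd od ed]]; exists (flip d);
  by rewrite org_flip end_flip Fd od ed.
Qed.

Lemma cc_eq u v : (cc u == cc v) = connect adjF u v.
Proof. by apply: root_connect; exact: sym_connect_sym adjF_sym. Qed.

Lemma cc_walk u v : reflect (exists s, [/\ walk u s v, noback s & inF s]) (cc u == cc v).
Proof.
rewrite cc_eq; apply: (iffP connectP) => [[p pp ->]|[s [ws _ Fs]]].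
  suff [s [ws Fs]] : exists s, walk u s (last u p) /\ inF s.
    exists (reduce s); split; [exact: reduce_walk | exact: reduce_noback |].
    exact: all_reduce.
  elim: p u pp => [|w p IH] u /=; first by exists [::]; rewrite /= eqxx.
  case/andP=> /existsP[d /and3P[Fd /eqP od /eqP ed]] /IH[s [ws Fs]].
  by exists (d :: s); rewrite /= od ed eqxx ws Fd.
elim: s u ws Fs => [|d s IH] u /=; first by move=> /eqP-> _; exists [::].
case/andP=> /eqP ou ws /andP[Fd Fs]; have [p pp lp] := IH _ ws Fs.
exists (end_ d :: p) => //=; rewrite pp andbT; apply/existsP; exists d.
by rewrite Fd ou !eqxx.
Qed.

Lemma walk_cc u s v : walk u s v -> inF s -> cc u == cc v.
Proof.
move=> ws Fs; apply/cc_walk; exists (reduce s).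
by split; [exact: reduce_walk | exact: reduce_noback | exact: all_reduce].
Qed.

Definition fill u v : seq (dart G) :=
  xget [::] [set s | [/\ walk u s v, noback s & inF s]]%classic.

Lemma fillP u v : cc u == cc v ->
  [/\ walk u (fill u v) v, noback (fill u v) & inF (fill u v)].
Proof. by move=> /cc_walk h; exact: (xgetPex [::] h). Qed.

Lemma fill_uniq u v s : walk u s v -> noback s -> inF s -> fill u v = s.
Proof.
move=> ws ns Fs; have [] : [/\ walk u (fill u v) v, noback (fill u v) & inF (fill u v)].
  by apply: fillP; apply/cc_walk; exists s.
by move=> wf nf Ff; apply: (forest_walk_uniq forestF wf ws).
Qed.

(** The turns of the collapsed graph, whose edges are those outside [F]. *)
Definition hturn : rel (dart G) := fun d d' =>
  [&& pos d, pos d', cc (end_ d) == cc (org d') & d' != flip d].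

(** The [f]-length of the segment from [d] (excluded) to [d'] (included) of a
    tight path that runs through [F] in between. *)
Definition seg f d d' : R := \sum_(x <- fill (end_ d) (org d')) f x.1 + f d'.1.

Lemma path_turn_walk d s : path turn d s -> walk (end_ d) s (end_ (last d s)).
Proof.
elim: s d => [|d' s IH] d /=; first by rewrite eqxx.
by case/andP=> /andP[/eqP-> _] /IH->; rewrite eqxx.
Qed.

Lemma path_turn_noback d s : path turn d s -> noback (d :: s).
Proof. by apply: sub_path => x y /andP[]. Qed.

(** Reduced paths through the forest are unique, so each stretch of a tight path
    between two edges outside [F] is the one that [fill] selects; [s1] is the
    part of the current stretch already read. *)
Lemma collapse_path s1 s d : inF s1 -> pos d -> path turn d (s1 ++ s) ->
  pos (last d (s1 ++ s)) ->
  path hturn d (seq.filter pos s) /\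
  forall f, \sum_(x <- s1 ++ s) f x.1 = psum (seg f) d (seq.filter pos s).
Proof.
elim: s s1 d => [|x s IH] s1 d Fs1 pd.
  rewrite cats0 => _; case/lastP: s1 Fs1 => [|s1 y]; first by split=> // f; rewrite big_nil.
  by rewrite last_rcons /inF all_rcons /pos => /andP[->].
have [px|/negbNE Fx] := boolP (pos x); last first.
  have -> : seq.filter pos (x :: s) = seq.filter pos s by rewrite /= /pos Fx.
  rewrite -cat_rcons => pt pl; apply: IH => //.
  by rewrite /inF all_rcons Fx.
rewrite {1}cat_path last_cat => /andP[pt1] /= /andP[tx pts] pl.
have [hs Es] := IH [::] x isT px pts pl.
have w1 : walk (end_ d) s1 (org x).
  by move: tx => /andP[/eqP<- _]; exact: path_turn_walk.
have n1 : noback s1 by exact: path_sorted (path_turn_noback pt1).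
have xd : x != flip d.
  case: s1 Fs1 pt1 w1 n1 tx {IH} => [|y s1] Fs1 pt1 w1 n1 tx; first by case/andP: tx.
  apply/eqP => xd; move: w1; rewrite xd org_flip => w1.
  by have := forest_closed forestF w1 n1 Fs1.
rewrite /= px /=; split.
  rewrite hs andbT /hturn pd px xd andbT /=.
  by apply/cc_walk; exists s1.
move=> f; rewrite big_cat big_cons /= -Es /seg (fill_uniq w1 n1 Fs1).
by rewrite addrA.
Qed.

(** A tight path, read off from one of its edges outside [F], is determined by
    the cyclic word of its edges outside [F]. *)
Lemma collapse_tight q x : tight q -> x \in q -> pos x ->
  exists s, [/\ perm_eq (x :: s) (seq.filter pos q), cycle hturn (x :: s) &
    forall f, \sum_(y <- q) f y.1 = csum (seg f) (x :: s)].
Proof.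
move=> tq xq px; have [i t Eq] := rot_to xq.
have pt : path turn x (rcons t x) by rewrite -[path _ _ _]/(cycle turn (x :: t)) -Eq rot_cycle.
have [] := @collapse_path [::] (rcons t x) x isT px pt.
  by rewrite last_rcons.
rewrite filter_rcons px => h E; exists (seq.filter pos t); split=> //.
  have -> : x :: seq.filter pos t = seq.filter pos (x :: t) by rewrite /= px.
  by rewrite -Eq; apply: perm_filter; rewrite perm_rot.
move=> f; rewrite /csum -E cat0s [LHS](perm_big (x :: t)) /=.
  by rewrite [RHS](perm_big (x :: t)) // perm_rcons.
by rewrite -Eq perm_sym perm_rot.
Qed.

Lemma tight_pos q : tight q -> q <> [::] -> exists2 x, x \in q & pos x.
Proof.
move=> tq q0; have /allPn[x xq px] := forestF (tight_is_loop tq q0).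
by exists x.
Qed.

(** No backtrack arises where a path of the forest is inserted, since a dart in
    the forest is never inverse to one outside it. *)
Lemma path_fill d d' : hturn d d' -> path turn d (rcons (fill (end_ d) (org d')) d').
Proof.
case/and4P=> pd pd' /fillP; move: (fill _ _) => z [wz nz Fz] dd'.
case: z wz nz Fz => [|e z] wz nz Fz.
  by rewrite /= andbT /turn dd' andbT.
have ne : e != flip d.
  by apply: contraNneq pd => ed; case/andP: Fz; rewrite ed.
have := walk_path (org d) d (e :: z) (org d').
have -> : walk (org d) (d :: e :: z) (org d') by rewrite /= eqxx.
have -> : noback (d :: e :: z) by rewrite /noback /= ne.
case/esym/and3P=> _ pt el; rewrite rcons_path pt /turn el /=.
apply: contraNneq pd' => ->; have /allP Fz' := Fz.
exact: Fz' (mem_last e z).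
Qed.

Lemma expand_path d s : path hturn d s -> exists t,
  [/\ path turn d t, seq.filter pos t = s, last d t = last d s &
    forall f, \sum_(y <- t) f y.1 = psum (seg f) d s].
Proof.
elim: s d => [|x s IH] d /=.
  by exists [::]; split=> // f; rewrite big_nil.
case/andP=> h /IH[t [pt ft lt Et]]; exists (rcons (fill (end_ d) (org x)) x ++ t).
split.
- by rewrite cat_path path_fill // last_rcons.
- case/and4P: h => _ px /fillP[_ _ Fz] _.
  rewrite filter_cat filter_rcons px ft -[RHS]cat1s -cats1; congr (_ ++ _).
  rewrite -[RHS]cat0s; congr (_ ++ _); apply/eqP; rewrite -[_ == _]negbK -has_filter.
  by apply/hasPn => y /(allP Fz); rewrite /pos negbK.
- by rewrite last_cat last_rcons.
- by move=> f; rewrite big_cat -cats1 big_cat big_seq1 /= Et.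
Qed.

Lemma expand_cycle s : cycle hturn s -> s <> [::] -> exists q,
  [/\ tight q, q <> [::], perm_eq (seq.filter pos q) s &
    forall f, \sum_(y <- q) f y.1 = csum (seg f) s].
Proof.
case: s => // d s /expand_path[t [pt ft lt Et]] _; exists t; split=> //.
- case: t pt lt {ft Et} => // x t; rewrite last_rcons => pt lt.
  by rewrite /tight (cycle_path d) lt.
- by move=> t0; move: ft; rewrite t0; case: (s).
- by rewrite ft perm_rcons.
Qed.

(** A potential that makes all turns nonnegative does so for the turns of the
    collapsed graph. *)
Lemma seg_potential f (pi : dart G -> R) :
  (forall d d', turn d d' -> 0 <= f d'.1 + pi d - pi d') ->
  forall d d', hturn d d' -> 0 <= seg f d d' + pi d - pi d'.
Proof.
move=> f0 d d' /path_fill.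
have -> : seg f d d' = \sum_(y <- rcons (fill (end_ d) (org d')) d') f y.1.
  by rewrite -cats1 big_cat big_seq1.
rewrite -[X in _ - pi X](last_rcons d (fill (end_ d) (org d')) d').
move: (rcons _ _) => s; elim: s d => [|x s IH] d /=.
  by rewrite big_nil add0r subrr.
by case/andP=> /f0 h /IH; rewrite big_cons; lra.
Qed.

End Collapse.

(** * Potentials *)

(** The potential of [y] is the least cost of a simple path that ends at [y];
    prolonging such a path to a successor keeps it simple or closes a cycle,
    which may be dropped because its cost is nonnegative. *)
Lemma exists_potential (R : realType) (T : finType) (r : rel T) (f : T -> R) :
  (forall c, cycle r c -> 0 <= \sum_(x <- c) f x) ->
  exists pi : T -> R, forall x y, r x y -> 0 <= f y + pi x - pi y.
Proof.
move=> cyc0.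
pose A y := [set c | exists2 s, uniq (rcons s y) && sorted r (rcons s y) &
                     c = \sum_(z <- rcons s y) f z]%classic.
have A0 y : (A y !=set0)%classic by exists (\sum_(z <- rcons [::] y) f z), [::].
have lbA y : has_lbound (A y).
  exists (- \sum_x `|f x|) => c [s /andP[us _] ->].
  rewrite [X in _ <= X]big_uniq //= lerNl -sumrN; apply: (@le_trans _ _ (\sum_(z in rcons s y) `|f z|)).
    by apply: ler_sum => z _; rewrite -normrN ler_norm.
  by rewrite [X in _ <= X](bigID (mem (rcons s y))) /= lerDl sumr_ge0.
exists (fun y => inf (A y)) => x y rxy.
suff: inf (A y) - f y <= inf (A x) by lra.
apply: lb_le_inf => // c [s /andP[us ps] ->].
rewrite lerBlDr; have [ys|yNs] := boolP (y \in rcons s x); last first.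
  apply: ge_inf => //; exists (rcons s x); last first.
    by rewrite -[X in _ = X]/(\sum_(z <- _) _) -[rcons (rcons s x) y]cats1 big_cat big_seq1.
  rewrite rcons_uniq yNs us /=.
  case: (s) ps => [|a t] /= ps; first by rewrite rxy.
  by rewrite rcons_path ps last_rcons rxy.
have [q1 [q2 Eq]] : exists q1 q2, rcons s x = rcons q1 y ++ q2.
  by case/splitPr: ys => q1 q2; exists q1, q2; rewrite cat_rcons.
have lq : last y q2 = x.
  by have := congr1 (last y) Eq; rewrite last_rcons last_cat last_rcons.
have ps1 : sorted r (rcons q1 y) && path r y q2.
  by rewrite -sorted_cat_cons -cat_rcons -Eq.
have c0 : 0 <= \sum_(z <- y :: q2) f z.
  by apply: cyc0; rewrite /= rcons_path lq rxy; case/andP: ps1 => _ ->.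
rewrite Eq big_cat /= -addrA.
rewrite big_cons addrC in c0.
apply: (@le_trans _ _ (\sum_(z <- rcons q1 y) f z)); last by rewrite lerDl.
apply: ge_inf => //; exists q1 => //.
case/andP: ps1 => -> _; rewrite andbT.
by move: us; rewrite Eq cat_uniq => /andP[].
Qed.

Lemma next_neq (T : eqType) (s : seq T) x :
  uniq s -> x \in s -> (1 < size s)%N -> next s x != x.
Proof.
move=> us xs s1; have [i t Es] := rot_to xs.
rewrite -(next_rot i us) Es; move: us s1; rewrite -(rot_uniq i) -(size_rot i) Es.
case: t {Es} => // y t /= /andP[]; rewrite inE negb_or eqxx => /andP[xy _] _ _.
by rewrite eq_sym.
Qed.

(** Turning at each vertex to the next dart in a cyclic order of its star. *)
Lemma exists_turn_perm (G : complex1) : (forall v : vert G, (1 < valence v)%N) ->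
  exists2 sigma : dart G -> dart G, injective sigma & forall d, turn d (sigma d).
Proof.
move=> val2; pose star (v : vert G) := enum [set d : dart G | org d == v]%SET.
have inS d v : (d \in star v) = (org d == v) by rewrite mem_enum inE.
have uS v : uniq (star v) by apply: enum_uniq.
have oS d : org (next (star (end_ d)) (flip d)) = end_ d.
  by apply/eqP; rewrite -inS mem_next inS org_flip.
exists (fun d => next (star (end_ d)) (flip d)).
  move=> d d' E; have Ee : end_ d = end_ d' by rewrite -oS E oS.
  move: E; rewrite Ee => /(can_inj (prev_next (uS _))).
  exact: (can_inj (@flipK G)).
move=> d; rewrite /turn oS eqxx /=; apply: next_neq => //.
  by rewrite inS org_flip.
by have := val2 (end_ d); rewrite /valence cardE.
Qed.

(** * Covering a cyclic word by words that visit each vertex at most twice *)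

Section Covering.
Variables (R : realType) (T : eqType) (V : finType).
Variables (fl : T -> T) (o : T -> V) (pos : pred T) (h : rel T).
Hypotheses (flK : involutive fl) (fl_neq : forall x, fl x != x).
Hypothesis hE : forall x y,
  h x y = [&& pos x, pos y, o (fl x) == o y & y != fl x].
Hypothesis pos_fl : forall x, pos (fl x) = pos x.

Lemma h_end x y : h x y -> o (fl x) = o y.
Proof. by rewrite hE => /and4P[_ _ /eqP]. Qed.

Lemma h_pos x y : h x y -> pos x && pos y.
Proof. by rewrite hE => /and4P[-> ->]. Qed.

Lemma h_fl x y : h (fl y) (fl x) = h x y.
Proof.
rewrite !hE !flK !pos_fl [o y == _]eq_sym [fl x == _]eq_sym.
by case: (pos x); case: (pos y).
Qed.

Variables (k : T -> T -> R) (len : T -> R) (c : R).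
Hypothesis k_ge0 : forall x y, h x y -> 0 <= k x y.
Hypothesis len_ge0 : forall x, 0 <= len x.
Hypothesis len_fl : forall x, len (fl x) = len x.
Hypothesis c_ge0 : 0 <= c.
Hypothesis twice_le : forall s, s <> [::] -> cycle h s ->
  (forall v, (count (fun x => o x == v) s <= 2)%N) ->
  csum k s <= c * \sum_(x <- s) len x.

Lemma psum_ge0 x s : path h x s -> 0 <= psum k x s.
Proof. by elim: s x => //= y s IH x /andP[hxy /IH]; apply: addr_ge0; exact: k_ge0. Qed.

Lemma csum_ge_psum x s t : cycle h (x :: s ++ t) -> psum k x s <= csum k (x :: s ++ t).
Proof.
rewrite /csum /= rcons_cat cat_path psum_cat => /andP[_ /psum_ge0].
by rewrite lerDl.
Qed.

Section Walk.
Variable d : nat -> T.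
Hypothesis hd : forall i, h (d i) (d i.+1).
Let p i := o (d i).
Let Lam n : R := \sum_(0 <= i < n) len (d i).
Let kap a b : R := \sum_(a <= i < b) k (d i.-1) (d i).
Let W a b := [seq d i | i <- index_iota a b].

(** The first repetition of a vertex after time [t]. In particular [ret a a b]
    says that the walk runs through a simple cycle from time [a] to time [b]. *)
Definition ret t a b := [/\ (t <= a < b)%N, p a = p b &
  forall i j, (t <= i)%N -> (i < j <= b)%N -> p i = p j -> i = a /\ j = b].

Lemma ret_self t a b : ret t a b -> ret a a b.
Proof.
case=> /andP[ta ab] pab u; split=> //; first by rewrite leqnn.
by move=> i j ai; apply: u; exact: leq_trans ai.
Qed.

Lemma exists_ret t : exists a b, ret t a b.
Proof.
pose P j := [exists i : 'I_j, (t <= i)%N && (p i == p j)].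
have exP : exists j, P j.
  apply: contrapT => nP.
  have inj : injective (fun i : 'I_(#|V|).+1 => p (t + i)).
    move=> i j pij; apply/val_inj; apply: contrapT => /eqP nij.
    wlog ij : i j pij nij / (i < j)%N.
      by move=> H; move: (nij); rewrite neq_ltn => /orP[]; apply: H => //; rewrite eq_sym.
    apply: nP; exists (t + j)%N; have ltij : (t + i < t + j)%N by rewrite ltn_add2l.
    by apply/existsP; exists (Ordinal ltij); rewrite /= leq_addr pij eqxx.
  by have := leq_card _ inj; rewrite card_ord ltnn.
case: (ex_minnP exP) => b /existsP[a /andP[ta /eqP pab]] bmin.
exists (val a), b; split=> //; first by rewrite ta ltn_ord.
move=> i j ti /andP[ij jb] pij.
have jE : j = b.
  apply/eqP; rewrite eqn_leq jb /=; apply: bmin; apply/existsP.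
  by exists (Ordinal ij); rewrite /= ti pij eqxx.
rewrite jE in ij pij *; split=> //; apply: contrapT => /eqP nia.
have [e1|e2] : (i < a)%N \/ (a < i)%N by apply/orP; rewrite -neq_ltn.
  have: P (val a) by apply/existsP; exists (Ordinal e1); rewrite /= ti pij pab eqxx.
  by move/bmin; rewrite leqNgt ltn_ord.
have: P i by apply/existsP; exists (Ordinal e2); rewrite /= ta pij pab eqxx.
by move/bmin; rewrite leqNgt ij.
Qed.

Lemma p_succ i : o (fl (d i)) = p i.+1.
Proof. exact: h_end. Qed.

Lemma h_mk i j : p i.+1 = p j -> d j != fl (d i) -> h (d i) (d j).
Proof.
move=> pij nd; rewrite hE nd p_succ pij eqxx.
by case/andP: (h_pos (hd i)) => -> _; case/andP: (h_pos (hd j)) => ->.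
Qed.

Lemma W_cons a b : (a < b)%N -> W a b = d a :: W a.+1 b.
Proof. by move=> ab; rewrite /W /index_iota -(subnSK ab). Qed.

Lemma W_last a b : (a < b)%N -> last (d a) (W a.+1 b) = d b.-1.
Proof.
move=> ab; rewrite /W last_map /index_iota.
have E n : last a (iota a.+1 n) = (a + n)%N.
  by elim: n a {ab} => [|n IH] a /=; rewrite ?addn0 // IH addSnnS.
by rewrite E; congr d; lia.
Qed.

Lemma W_path a n : path h (d a) (map d (iota a.+1 n)).
Proof. by elim: n a => //= n IH a; rewrite hd IH. Qed.

Lemma W_sorted a b : sorted h (W a b).
Proof.
have [ab|ba] := ltnP a b; first by rewrite W_cons //; apply: W_path.
by rewrite /W /index_iota; have -> : (b - a = 0)%N by lia.
Qed.

Lemma psum_W a b : psum k (d a) (W a.+1 b) = kap a.+1 b.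
Proof.
rewrite /kap /W /index_iota; move: (b - a.+1)%N => n; elim: n a => [|n IH] a /=.
  by rewrite big_nil.
by rewrite big_cons IH.
Qed.

Lemma len_W a b : (a <= b)%N -> \sum_(x <- W a b) len x = Lam b - Lam a.
Proof.
move=> ab; have -> : Lam b = Lam a + \sum_(x <- W a b) len x.
  by rewrite /Lam (big_cat_nat (leq0n a) ab) big_map.
by rewrite addrC addKr.
Qed.

Lemma Lam_mono : {homo Lam : a b / (a <= b)%N >-> a <= b}.
Proof.
by move=> a b ab; rewrite /Lam [X in _ <= X](big_cat_nat (leq0n a) ab) /= lerDl sumr_ge0.
Qed.

Lemma kap_ge0 a b : (0 < a)%N -> 0 <= kap a b.
Proof.
by case: a => // a _; rewrite -psum_W; apply: psum_ge0; apply: W_path.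
Qed.

Lemma kap_cat a b e : (a <= b)%N -> (b <= e)%N -> kap a e = kap a b + kap b e.
Proof. by move=> ab be; rewrite /kap (big_cat_nat ab be). Qed.

Lemma count_W a b v : (forall i j, (a <= i)%N -> (i < j < b)%N -> p i <> p j) ->
  (count (fun x => o x == v) (W a b) <= 1)%N.
Proof.
move=> inj; rewrite /W count_map.
rewrite (@eq_count _ _ (preim p (pred1 v))) // -count_map count_uniq_mem ?leq_b1 //.
rewrite map_inj_in_uniq ?iota_uniq // => i j; rewrite !mem_index_iota => hi hj pij.
by apply/eqP; apply: contrapT => /negP; rewrite neq_ltn => /orP[] ij;
  [apply: (inj i j) | apply: (inj j i)] => //; lia.
Qed.

(** A word between two consecutive visits of a vertex closes up to a turn:
    a backtrack at the closing point would be an earlier repetition. *)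
Lemma ret_loop a b : ret a a b ->
  cycle h (W a b) /\ (forall v, (count (fun x => o x == v) (W a b) <= 1)%N).
Proof.
case=> /andP[_ ab] pab u; split; last first.
  by move=> v; apply: count_W => i j ai ijb pij; have [] := u i j ai _ pij; lia.
rewrite W_cons //= rcons_path W_path W_last //=.
apply: h_mk; first by rewrite prednK ?pab //; lia.
apply/eqP => E; have E1 : p a.+1 = p b.-1 by rewrite -p_succ E flK.
have [l1|l1] := ltnP a.+1 b.-1; first by have [] := u a.+1 b.-1 _ _ E1; lia.
have [e2|e2] : b.-1 = a \/ b.-1 = a.+1 by lia.
  by move: E; rewrite e2 => /esym/eqP; rewrite (negbTE (fl_neq _)).
have := hd a; rewrite hE -e2 => /and4P[_ _ _ /negP]; apply.
by rewrite E flK.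
Qed.

(** Two consecutive simple cycles without overlap are joined by a path. The word
    that runs through both cycles and through this path back and forth visits no
    vertex three times and has no backtrack: either would give a repetition
    after time [a] and before time [b'], which is the first one. *)
Lemma barbell_loop a b a' b' : ret a a b -> ret a.+1 a' b' -> (b <= a')%N ->
  kap a.+1 b' <= c * ((Lam b' - Lam a) + (Lam a' - Lam b)).
Proof.
move=> [/andP[_ ab] pab u] [/andP[aa' ab'] pab' u'] ba'.
have abb' : (a < b')%N by lia.
pose S2 := rev (map fl (W b a')).
have lenS2 : \sum_(x <- S2) len x = Lam a' - Lam b.
  rewrite -len_W // /S2 (perm_big (map fl (W b a'))) /=; last by rewrite perm_rev.
  rewrite big_map.
  by apply: eq_bigr => x _; rewrite len_fl.
have cyc : cycle h (d a :: W a.+1 b' ++ S2).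
  rewrite /= rcons_cat cat_path W_path W_last //=.
  have [eba'|nba'] := eqVneq b a'.
    rewrite /S2 /W -eba' /index_iota subnn /= andbT.
    apply: h_mk; first by rewrite prednK -?pab' -?eba' ?pab //; lia.
    apply/eqP => E; have E1 : p a.+1 = p b'.-1 by rewrite -p_succ E flK.
    have [l1|l1] := ltnP a.+1 b'.-1; first by have [] := u' a.+1 b'.-1 _ _ E1; lia.
    have e2 : b'.-1 = a.+1 by lia.
    have := hd a; rewrite hE -e2 => /and4P[_ _ _ /negP]; apply.
    by rewrite E flK.
  have lba' : (b < a')%N by lia.
  have e1 : d b'.-1 <> d a'.-1.
    move=> E; have E1 : p a'.-1 = p b'.-1 by rewrite /p E.
    by have [] := u' a'.-1 b'.-1 _ _ E1; lia.
  have ES : S2 = fl (d a'.-1) :: behead S2.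
    rewrite /S2 /W /index_iota.
    have -> : (a' - b = (a'.-1 - b).+1)%N by lia.
    rewrite -addn1 iotaD !map_cat rev_cat /=; congr (fl (d _) :: _); lia.
  have lS : last (d b'.-1) S2 = fl (d b).
    by rewrite /S2 W_cons //= rev_cons last_rcons.
  have sS : sorted h S2.
    rewrite /S2 rev_sorted sorted_map; have := W_sorted b a'.
    by apply: sub_sorted => x y /=; rewrite h_fl.
  rewrite rcons_path lS; apply/andP; split.
    move: sS; rewrite ES /= => ->; rewrite andbT.
    rewrite hE pos_fl; case/andP: (h_pos (hd b'.-1)) => -> _.
    case/andP: (h_pos (hd a'.-1)) => -> _ /=.
    rewrite !p_succ !prednK ?pab' ?eqxx /=; [|lia|lia].
    by rewrite (inj_eq (inv_inj flK)); apply/eqP => E; apply: e1; rewrite E.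
  rewrite hE flK pos_fl; case/andP: (h_pos (hd b)) => -> _.
  case/andP: (h_pos (hd a)) => -> _ /=; rewrite -/(p b) -/(p a) pab eqxx /=.
  apply/eqP => E; have E1 : p a.+1 = p b.+1 by rewrite -!p_succ E.
  by have [] := u' a.+1 b.+1 _ _ E1; lia.
have := csum_ge_psum cyc; rewrite psum_W => /le_trans; apply.
have -> : d a :: W a.+1 b' ++ S2 = W a b' ++ S2 by rewrite (W_cons abb').
rewrite -lenS2 -len_W; last by lia.
rewrite -big_cat; apply: twice_le.
- by rewrite W_cons.
- by rewrite W_cons.
move=> v; rewrite count_cat W_cons //=.
have c1 : (count (fun x => o x == v) (W a.+1 b') <= 1)%N.
  by apply: count_W => i j ai ijb pij; have [] := u' i j ai _ pij; lia.
have ES2 : count (fun x => o x == v) S2 = count (fun x => o x == v) (W b.+1 a'.+1).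
  rewrite /S2 count_rev /W /index_iota subSS !count_map -[b.+1]add1n iotaDl count_map.
  by apply: eq_count => i /=; rewrite p_succ.
rewrite ES2 -/(p a); have [pav|npa] := eqVneq (p a) v; last first.
  have: (count (fun x => o x == v) (W b.+1 a'.+1) <= 1)%N.
    by apply: count_W => i j ai ijb pij; have [] := u' i j _ _ pij; lia.
  by lia.
suff -> : count (fun x => o x == v) (W b.+1 a'.+1) = 0%N by lia.
apply/eqP; rewrite -leqn0 leqNgt -has_count; apply/hasPn => x /mapP[i].
rewrite mem_index_iota => hi ->; rewrite -pav pab; apply/eqP => pib.
by have [] := u' b i _ _ (esym pib); lia.
Qed.

(** The state of the greedy covering: the turns between times [b0] and [b] are
    paid for, and the last cycle used runs from [a] to [b]. Up to now times before
    [a] have been charged at most three times, times between [a] and [m] at most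
    twice and times between [m] and [b] once. Since no later cycle starts before
    [m], only times charged at most once lie on an overlapping cycle. *)
Definition covered b0 a m b :=
  [/\ ret a a b, (m <= b)%N, (forall s e, (a < s)%N -> ret s s e -> (m <= s)%N),
      (0 < b0 <= b)%N & kap b0 b <= c * (Lam a + Lam m + Lam b)].

(** If some simple cycle starts inside the last one, the one that starts last
    pays for the turns after [b]. Otherwise the next simple cycle starts at or
    after [b], and the last cycle is charged once more, as a part of the barbell
    with the next one. *)
Lemma covered_step b0 a m b : covered b0 a m b ->
  exists a' m' b', (b < b')%N /\ covered b0 a' m' b'.
Proof.
case=> rab mb am /andP[b0_gt0 b0b] kb.
have [_ ab] : (a <= a)%N /\ (a < b)%N by case: rab => /andP[].
pose start s := `[< exists e, ret s s e >].
have [[s0 /andP[/andP[as0 s0b] st0]]|noS] :=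
    pselect (exists s, (a < s < b)%N && start s).
  have exS : exists s, (a < s < b)%N && start s by exists s0; rewrite as0 s0b.
  have bdS s : (a < s < b)%N && start s -> (s <= b)%N by case/andP=> /andP[_ /ltnW].
  case: (ex_maxnP exS bdS) => a' /andP[/andP[aa' a'b] /asboolP[b' rab']] maxa'.
  have a'b' : (a' < b')%N by case: rab' => /andP[].
  have bb' : (b < b')%N.
    rewrite ltnNge; apply/negP => b'b; case: rab => _ _ u; case: rab' => _ pab' _.
    by have [] := u a' b' (ltnW aa') _ pab'; lia.
  have ma' : (m <= a')%N by apply: am rab'.
  exists a', b, b'; split=> //; split=> //.
  - exact: ltnW.
  - move=> s e a's rse; rewrite leqNgt; apply/negP => sb.
    have /maxa' : (a < s < b)%N && start s.
      by rewrite sb (ltn_trans aa' a's); apply/asboolP; exists e.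
    by lia.
  - by lia.
  have [cyc cnt] := ret_loop rab'.
  have: kap b b' <= c * (Lam b' - Lam a').
    rewrite -len_W; last by lia.
    apply: le_trans (twice_le _ cyc _); first last.
    - by move=> v; apply: leq_trans (cnt v) _.
    - by rewrite W_cons.
    have := cyc; rewrite (W_cons a'b') -[W a'.+1 b']cats0 => /csum_ge_psum.
    rewrite psum_W cats0; apply: le_trans.
    by rewrite (@kap_cat a'.+1 b b') //; [rewrite lerDr kap_ge0 | lia].
  have L1 : Lam a <= Lam a' by apply: Lam_mono; lia.
  have L2 : Lam m <= Lam a' by apply: Lam_mono.
  have : c * (Lam a + Lam m) <= c * (Lam a' + Lam a').
    by apply: ler_wpM2l => //; exact: lerD.
  rewrite (@kap_cat b0 b b') //; last by lia.
  by move: kb; rewrite !mulrDr mulrN; lra.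
have [a' [b' rab']] := exists_ret a.+1.
have aa' : (a < a')%N by case: rab' => /andP[].
have a'b' : (a' < b')%N by case: rab' => /andP[].
have ba' : (b <= a')%N.
  rewrite leqNgt; apply/negP => a'b; apply: noS; exists a'; rewrite aa' a'b /=.
  by apply/asboolP; exists b'; apply: ret_self rab'.
exists a', a', b'; split; first by lia.
split; [exact: ret_self rab' | exact: ltnW | by move=> s e /ltnW | lia |].
have kab : kap b b' <= kap a.+1 b'.
  by rewrite (@kap_cat a.+1 b b') //; [rewrite lerDr kap_ge0 | lia].
have := le_trans kab (barbell_loop rab rab' ba').
have : c * Lam m <= c * Lam a' by apply: ler_wpM2l => //; apply: Lam_mono; lia.
rewrite (@kap_cat b0 b b') //; last by lia.
by move: kb; rewrite !mulrDr !mulrN; lra.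
Qed.

Lemma walk_covered : exists2 b0, (0 < b0)%N & forall N, exists b,
  [/\ (N <= b)%N, (b0 <= b)%N & kap b0 b <= 3 * c * Lam b].
Proof.
have [a [b0 r0]] := exists_ret 0.
have ab0 : (a < b0)%N by case: r0 => /andP[].
exists b0; first by lia.
suff H N : exists a m b, (N <= b)%N /\ covered b0 a m b.
  move=> N; have [a1 [m [b [Nb [rab mb _ /andP[_ b0b] kb]]]]] := H N.
  exists b; split=> //; apply: (le_trans kb).
  have a1b : (a1 < b)%N by case: rab => /andP[].
  have L1 : Lam a1 <= Lam b by apply: Lam_mono; lia.
  have L2 : Lam m <= Lam b by apply: Lam_mono.
  rewrite -mulrA [X in _ <= X]mulrCA; apply: ler_wpM2l => //; lra.
elim: N => [|N [a1 [m [b [Nb cov]]]]]; last first.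
  have [a' [m' [b' [bb' cov']]]] := covered_step cov.
  by exists a', m', b'; split=> //; lia.
exists a, a, b0; split=> //; split.
- exact: ret_self r0.
- exact: ltnW.
- by move=> s e /ltnW.
- by rewrite leqnn andbT; lia.
rewrite /kap big_geq // mulr_ge0 //.
by rewrite !addr_ge0 // sumr_ge0.
Qed.

End Walk.

(** Run through the word infinitely often. The covering costs at most three
    times its length per period, up to an amount that does not grow with the
    number of periods. *)
Lemma thrice_le s : cycle h s -> csum k s <= 3 * c * \sum_(x <- s) len x.
Proof.
case: s => [|x s] cyc; first by rewrite big_nil mulr0.
pose n := (size s).+1; pose d i := nth x (x :: s) (i %% n).
have dE i : (i < n)%N -> d i = nth x (x :: s) i by move=> i_n; rewrite /d modn_small.
have dn i : d (i + n)%N = d i by rewrite /d modnDr.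
have hd i : h (d i) (d i.+1).
  have := elimT (cycle_nthP h x _) cyc (i %% n)%N (ltn_pmod _ (ltn0Sn _)).
  by rewrite [size _]/= -/n -addn1 modnDml addn1.
pose Lam m : R := \sum_(0 <= i < m) len (d i).
pose kap a b : R := \sum_(a <= i < b) k (d i.-1) (d i).
have periodic (g : nat -> R) q : (forall i, g (i + n)%N = g i) ->
    \sum_(0 <= i < q * n) g i = q%:R * \sum_(0 <= i < n) g i.
  move=> gn; have gqn m i : g (i + m * n)%N = g i.
    by elim: m => [|m IH]; rewrite ?addn0 // mulSn addnCA addnC gn.
  elim: q => [|q IH]; first by rewrite mul0n big_geq // mul0r.
  rewrite mulSn addnC (@big_cat_nat _ _ _ (q * n)) //=; last exact: leq_addr.
  rewrite IH -{1}[(q * n)%N]add0n big_addn addKn -[q.+1%:R]natr1 mulrDl mul1r.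
  by congr (_ + _); apply: eq_bigr => i _.
have LamE q : Lam (q * n)%N = q%:R * \sum_(y <- x :: s) len y.
  rewrite /Lam periodic; last by move=> i; rewrite dn.
  rewrite (big_nth x); congr (_ * _); apply: eq_big_nat => i /andP[_ i_n].
  by rewrite dE.
have psum_nth y t : psum k y t =
    \sum_(0 <= i < size t) k (nth x (y :: t) i) (nth x t i).
  elim: t y => [|z t IH] y /=; first by rewrite big_nil.
  by rewrite IH big_nat_recl.
have dS i : (i < n)%N -> d i.+1 = nth x (rcons s x) i.
  rewrite ltnS leq_eqVlt => /orP[/eqP ->|i_n].
    by rewrite /d modnn nth_rcons ltnn eqxx.
  by rewrite dE // nth_rcons i_n.
have kapE q : kap 1%N (q * n).+1 = q%:R * csum k (x :: s).
  rewrite /kap big_add1 /= periodic; last by move=> i; rewrite -addSn !dn.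
  congr (_ * _); rewrite psum_nth size_rcons; apply: eq_big_nat => i /andP[_ i_n].
  by rewrite -rcons_cons nth_rcons [size _]/= -/n i_n dE // dS.
have [b0 b0_gt0 cov] := walk_covered hd.
set S := csum k (x :: s); set L := \sum_(y <- _) _.
rewrite leNgt; apply/negP => SL.
pose C := kap 1%N b0 + 3 * c * L.
have L0 : 0 <= L by apply: sumr_ge0.
have c3 : 0 <= 3 * c by rewrite mulr_ge0.
have lin q : q%:R * (S - 3 * c * L) <= C.
  have [b [qb b0b kb]] := cov (q * n).+1.
  pose r := (b.-1 %/ n)%N.
  have rb : (r * n <= b.-1)%N by rewrite leq_divM.
  have br : (b.-1 < r.+1 * n)%N by rewrite ltn_ceil.
  have qr : (q <= r)%N by rewrite /r leq_divRL //; lia.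
  apply: (@le_trans _ _ (r%:R * (S - 3 * c * L))).
    by rewrite ler_wpM2r ?ler_nat // subr_ge0 ltW.
  have k1 : r%:R * S <= kap 1%N b.
    have -> : kap 1%N b = kap 1%N (r * n).+1 + kap (r * n).+1 b.
      by apply: kap_cat; lia.
    by rewrite -kapE lerDl; exact: kap_ge0.
  have E : kap 1%N b = kap 1%N b0 + kap b0 b by apply: kap_cat; lia.
  rewrite E in k1.
  have k2 : Lam b <= r.+1%:R * L by rewrite -LamE; apply: Lam_mono; lia.
  have : 3 * c * Lam b <= 3 * c * (r.+1%:R * L) by apply: ler_wpM2l.
  move: kb k1; rewrite /C -[r.+1%:R]natr1 -/(Lam b) -/(kap b0 b).
  by lra.
have := lin (Num.truncn (C / (S - 3 * c * L))).+1.
rewrite -ler_pdivlMr ?subr_gt0 //; apply/negP; rewrite -ltNge.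
exact: truncnS_gt.
Qed.
End Covering.

(** * Homology classes with a unique shape of shortest loops *)

Section Parity.
Variable G : complex1.
Implicit Types (p q : seq (dart G)) (e : edge G).

Definition crossings q e := count (fun d : dart G => d.1 == e) q.

Lemma natrF2 (n : nat) : n%:R = (odd n)%:R :> 'F_2.
Proof.
rewrite -[in LHS](odd_double_half n) -muln2 natrD natrM.
have -> : (2%:R : 'F_2) = 0 by apply/eqP.
by rewrite mulr0 addr0.
Qed.

Lemma boolF2_inj (b b' : bool) : b%:R = b'%:R :> 'F_2 -> b = b'.
Proof. by case: b; case: b' => // /eqP. Qed.

Lemma hclassP p q : hclass p = hclass q <->
  forall e, odd (crossings p e) = odd (crossings q e).
Proof.
split=> [E e|E]; last by apply/rowP => i; rewrite !mxE natrF2 E -natrF2.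
have := congr1 (fun a : 'rV_ _ => a 0 (enum_rank e)) E.
by rewrite !mxE enum_rankK natrF2 [RHS]natrF2 => /boolF2_inj.
Qed.

Lemma hclass_tighten p : hclass (tighten p) = hclass p.
Proof.
apply/hclassP => e; exact: (odd_count_tighten (pred1 e)).
Qed.

Lemma closed_path_H1 p : closed_path p -> hclass p \in H1_2 G.
Proof.
case: p => [_|d s].
  rewrite inE; apply/eqP/rowP => j; rewrite !mxE big1 // => i _.
  by rewrite !mxE /= mul0r.
rewrite closed_path_walk; move: (d :: s) => p.
suff H u v : walk u p v -> forall j, (hclass p *m boundary 'F_2 G) 0 j =
    (v == enum_val j)%:R - (u == enum_val j)%:R.
  by move=> /H E; rewrite inE; apply/eqP/rowP => j; rewrite E subrr mxE.
elim: p u => [|x p IH] u /=.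
  move=> /eqP-> j; rewrite subrr !mxE big1 // => i _.
  by rewrite !mxE /= mul0r.
case/andP=> /eqP ou /IH E j; rewrite mxE.
have -> : \sum_j0 hclass (x :: p) 0 j0 * boundary 'F_2 G j0 j =
   \sum_j0 (x.1 == enum_val j0)%:R * boundary 'F_2 G j0 j +
   \sum_j0 hclass p 0 j0 * boundary 'F_2 G j0 j.
  rewrite -big_split; apply: eq_bigr => i _ /=.
  by rewrite !mxE /= natrD mulrDl.
have := E j; rewrite mxE => ->.
rewrite (bigD1 (enum_rank x.1)) //= big1 => [|i]; last first.
  move=> ni; rewrite [_ == _](_ : _ = false) ?mul0r //.
  by apply: contraNF ni => /eqP->; rewrite enum_valK.
rewrite enum_rankK eqxx mul1r addr0 !mxE enum_rankK -ou.
have two (y : 'F_2) : y + y = 0 by rewrite -mulr2n -mulr_natr natrF2 mulr0.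
have sign (a b w : 'F_2) : a - b + (w - b) = w - a.
  transitivity (w - a + (a + a) - (b + b)); first by ring.
  by rewrite !two subr0 addr0.
by case: (x) => e []; rewrite /org /end_ /= ?sign //; ring.
Qed.

Lemma sum_crossings (R : realType) (f : edge G -> R) q :
  \sum_(d <- q) f d.1 = \sum_e f e * (crossings q e)%:R.
Proof.
elim: q => [|d q IH]; first by rewrite big_nil big1 // => e _; rewrite mulr0.
rewrite big_cons IH; under [RHS]eq_bigr => e _ do rewrite /= natrD mulrDr.
rewrite big_split /=; congr (_ + _).
rewrite (bigD1 d.1) //= eqxx mulr1 big1 ?addr0 // => e; rewrite eq_sym => /negbTE->.
by rewrite mulr0.
Qed.
End Parity.

Lemma map_uniq_inj (T : eqType) (S : eqType) (f : T -> S) s :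
  uniq (map f s) -> {in s &, injective f}.
Proof.
elim: s => //= a s IH /andP[na us] x y; rewrite !inE.
case/orP=> [/eqP->|xs] /orP[/eqP->|ys] // E; last exact: IH.
  by rewrite E map_f in na.
by rewrite -E map_f in na.
Qed.

Section SimpleWord.
Variables (R : realType) (X : complex1) (l : edge X -> R).
Hypothesis l_ge0 : forall e, 0 <= l e.
Let F : pred (edge X) := [pred e | l e == 0].
Hypothesis forestF : forest F.
Let h := hturn F.
Let cv := fun d : dart X => cc F (org d).

Variable s : seq (dart X).
Hypotheses (s0 : s <> [::]) (cyc : cycle h s) (us : uniq (map cv s)).

Lemma simple_next x y : x \in s -> h x y -> y \in s \/ flip y \in s ->
  y = next s x.
Proof.
move=> xs hxy; have hE z w : h z w -> cc F (end_ z) = cv w.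
  by case/and4P=> _ _ /eqP.
have ns z : z \in s -> cv (next s z) = cc F (end_ z).
  by move=> zs; rewrite -(hE z) //; apply: next_cycle.
have inj := map_uniq_inj us; have us' : uniq s := map_uniq us.
case=> ys; first by apply: inj => //; rewrite ?mem_next // ns // (hE _ _ hxy).
have E : next s (flip y) = next s x.
  by apply: inj; rewrite ?mem_next // !ns // end_flip (hE _ _ hxy).
have /(congr1 (prev s)) := E; rewrite !prev_next // => yx.
by case/and4P: hxy => _ _ _; rewrite -yx flipK eqxx.
Qed.

Lemma simple_edge_inj : {in s &, injective (fun d : dart X => d.1)}.
Proof.
move=> x y xs ys E.
have [//|yx] : y = x \/ y = flip x.
  move: E; case: (x) => e b; case: (y) => e' b' /= ->; rewrite /flip /=.
  by case: b; case: b'; auto.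
have hx := next_cycle cyc xs.
have: y = next s x.
  apply: (map_uniq_inj us) => //; rewrite ?mem_next //.
  by rewrite yx /cv org_flip; case/and4P: hx => _ _ /eqP.
by move=> E'; case/and4P: hx => _ _ _; rewrite -E' yx eqxx.
Qed.

Lemma simple_follow (g : dart X -> dart X -> R) x t : x \in s -> path h x t ->
  (forall z, z \in t -> z \in s \/ flip z \in s) ->
  {subset t <= s} /\ psum g x t = \sum_(z <- belast x t) g z (next s z).
Proof.
elim: t x => [|y t IH] x xs /=; first by split=> //; rewrite big_nil.
case/andP=> hxy pt ts; have yE : y = next s x.
  by apply: simple_next (ts y _); rewrite ?mem_head.
have ys : y \in s by rewrite yE mem_next.
have [|ss ->] := IH y ys pt; first by move=> z zt; apply: ts; rewrite inE zt orbT.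
split; last by rewrite big_cons {1}yE.
by move=> z; rewrite inE => /orP[/eqP->|/ss].
Qed.

(** After each dart the next one is forced, since only two of the available
    darts leave a given vertex, and one of them is a backtrack. So a cyclic word
    with the same edges that agrees with [s] at one dart is [s] up to rotation. *)
Lemma simple_csum (g : dart X -> dart X -> R) x t : x \in s -> cycle h (x :: t) ->
  perm_eq (map fst (x :: t)) (map fst s) -> csum g (x :: t) = csum g s.
Proof.
move=> xs cyct pe.
have ts z : z \in rcons t x -> z \in s \/ flip z \in s.
  rewrite mem_rcons => zt; have := map_f fst zt; rewrite (perm_mem pe).
  case/mapP=> y ys; case: y ys => e b ys; case: z zt => e' b' zt /= E.
  rewrite E /flip /=; case: (b =P b') => [<-|nb]; [by left | right].
  by have -> : ~~ b' = b by case: b b' nb {ys zt} => -[].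
have [ss E] := simple_follow g xs cyct ts.
have us' : uniq s := map_uniq us.
have ut : uniq (x :: t).
  by apply: (@map_uniq _ _ fst); rewrite (perm_uniq pe) (map_inj_in_uniq simple_edge_inj).
have pts : perm_eq (x :: t) s.
  have sub : {subset x :: t <= s} by move=> z zt; apply: ss; rewrite mem_rcons.
  have [|_ eq] := uniq_min_size ut sub; last exact: uniq_perm.
  by have := perm_size pe; rewrite !size_map => ->.
rewrite /csum E belast_rcons (perm_big _ pts) /=.
case: (s) s0 cyc simple_follow => // y r _ cycs follow.
have [|_ ->] := follow g y (rcons r y) (mem_head _ _) cycs.
  by move=> z; rewrite mem_rcons; left.
by rewrite belast_rcons.
Qed.

(** The class of the loop given by [s]. A representative crosses each edge of
    [s] an odd number of times, so it is no shorter than [s]. If it is no longer,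
    then it crosses each edge of [s] once and else only edges of length zero,
    and by [simple_csum] it has the same value as [s] for each [tau]. *)
Lemma simple_word : exists a, [/\ a \in H1_2 X, a != 0,
  min_length l a = \sum_(x <- s) l x.1 &
  forall tau, max_realizing l tau a = csum (seg F tau) s].
Proof.
have [q0 [tq0 q0n pq0 Eq0]] := @expand_cycle R X F s cyc s0.
have cross_pos q e : l e != 0 ->
    crossings q e = count (fun d => d.1 == e) (seq.filter (pos F) q).
  move=> le; rewrite /crossings count_filter; apply: eq_count => d /=.
  by case: eqP => // de; rewrite /pos /F /= de le.
have us1 : uniq (map fst s) by rewrite (map_inj_in_uniq simple_edge_inj) (map_uniq us).
have cross0 e : l e != 0 -> crossings q0 e = (e \in map fst s).
  move=> le; rewrite cross_pos // (permP pq0) -count_uniq_mem //.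
  by rewrite count_map.
have len_pos q : \sum_(d <- q) l d.1 = \sum_(d <- seq.filter (pos F) q) l d.1.
  rewrite big_filter [LHS](bigID (pos F)) /= [X in _ + X]big1 ?addr0 // => d.
  by rewrite negbK => /eqP.
have lenq0 : \sum_(d <- q0) l d.1 = \sum_(x <- s) l x.1.
  by rewrite len_pos (perm_big _ pq0).
have loop0 : is_loop q0 by apply: tight_is_loop.
pose a := hclass q0.
have rep0 : represents a q0 by [].
have le_cross p e : represents a p ->
    l e * (crossings q0 e)%:R <= l e * (crossings (tighten p) e)%:R.
  case=> _ /esym; rewrite -(hclass_tighten p) => /hclassP/(_ e).
  have [->|le] := eqVneq (l e) 0; first by rewrite !mul0r.
  rewrite cross0 // oddb => E; apply: ler_wpM2l => //; rewrite ler_nat.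
  move: E; case: (e \in _) => // /esym.
  exact: odd_gt0.
have val0 (f : edge X -> R) : value f q0 = csum (seg F f) s.
  by rewrite /value tighten_tight.
have min_len : min_length l a = \sum_(x <- s) l x.1.
  rewrite /min_length -lenq0; apply/eqP; rewrite eq_le; apply/andP; split.
    apply: ge_inf; last by exists q0 => //; rewrite /value tighten_tight.
    by exists 0 => _ [p _ <-]; apply: sumr_ge0.
  apply: lb_le_inf; first by exists (value l q0), q0.
  move=> _ [p rp <-]; rewrite /value !sum_crossings.
  by apply: ler_sum => e _; apply: le_cross.
have real p (f : edge X -> R) : realizes l a p -> value f p = csum (seg F f) s.
  case=> rp; rewrite min_len -lenq0 /value; set q := tighten p => lenq.
  have tq : tight q by case: rp => -[/tight_tighten].
  have cq e : l e != 0 -> crossings q e = crossings q0 e.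
    move=> le; have := lenq; rewrite !sum_crossings => E.
    have E0 : \sum_e (l e * (crossings q e)%:R - l e * (crossings q0 e)%:R) = 0.
      by rewrite sumrB E subrr.
    have := psumr_eq0P (fun i _ => _) E0 (erefl true).
    move=> /(_ _ e)/eqP; rewrite -mulrBr mulf_eq0 (negbTE le) subr_eq0 eqr_nat => H.
    by apply/eqP/H => i; rewrite subr_ge0 le_cross.
  have [x xs] : exists x, x \in s by case: (s) s0 => // x r _; exists x; rewrite mem_head.
  have px : l x.1 != 0 by have := next_cycle cyc xs; case/and4P.
  wlog xq : q tq cq {lenq} / x \in q.
    move=> H; have: (0 < crossings q x.1)%N by rewrite cq // cross0 // map_f.
    rewrite -has_count => /hasP[y yq /eqP yx].
    have [Ey|Ey] : x = y \/ x = flip y.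
      move: yx; case: (x) => e b; case: (y) => e' b' /= ->; rewrite /flip /=.
      by case: b; case: b'; auto.
    - by apply: H => //; rewrite Ey.
    have Er : \sum_(d <- q) f d.1 = \sum_(d <- rpath q) f d.1.
      rewrite [RHS](perm_big (map (@flip X) q)) ?perm_rev //= big_map.
      by apply: eq_bigr.
    rewrite Er; apply: H; rewrite ?tight_rpath //.
      by move=> e le; rewrite -cq // /crossings count_rev count_map.
    by rewrite mem_rev Ey map_f.
  have [t [pt cyct ->]] := @collapse_tight R X F forestF q x tq xq px.
  apply: simple_csum => //; apply: (@perm_trans _ (map fst (seq.filter (pos F) q))).
    exact: perm_map.
  rewrite perm_sym; apply: (@perm_trans _ (map fst (seq.filter (pos F) q0))).
    by apply: perm_map; rewrite perm_sym.
  apply/allP => e _; apply/eqP; rewrite /= !count_map.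
  have [e0|le] := eqVneq (l e) 0; last first.
    by rewrite -[RHS](cross_pos q e le) cq // cross_pos.
  by rewrite !count_filter !(eq_count (a2 := pred0)) ?count_pred0 // => d /=;
    apply/andP => -[/eqP E]; rewrite /pos /F /= E e0 eqxx.
exists a; split => //.
- by apply: closed_path_H1; case: loop0.
- have [x xs] : exists x, x \in s by case: (s) s0 => // x r _; exists x; rewrite mem_head.
  have px : l x.1 != 0 by have := next_cycle cyc xs; case/and4P.
  apply/eqP => a0; have: hclass q0 = hclass [::] :> 'rV['F_2]_#|edge X|.
    by rewrite -/a a0; apply/rowP => i; rewrite !mxE.
  by move/hclassP/(_ x.1); rewrite cross0 // map_f.
move=> tau; rewrite /max_realizing.
rewrite [X in sup X](_ : _ = [set csum (seg F tau) s]%classic) ?sup1 //.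
apply/seteqP; split=> [_ [p rp <-]|_ ->] /=; first exact: real.
exists q0; last exact: val0.
by split=> //; rewrite min_len -lenq0 /value tighten_tight.
Qed.

End SimpleWord.

(** * Double covers *)

Lemma connectedP (X : complex1) : connected X <->
  (0 < #|vert X|)%N /\ forall u v : vert X, exists s, walk u s v.
Proof.
have E u v : connect (@adj X) u v = (cc predT u == cc predT v).
  by rewrite cc_eq; apply: eq_connect.
split=> -[X0 c]; split=> // u v; have := c u v.
  by rewrite E => /cc_walk[s [ws _ _]]; exists s.
case=> s ws; rewrite E; apply/cc_walk; exists (reduce s).
by rewrite reduce_walk // reduce_noback /inF all_predT.
Qed.

Section Projection.
Variables (G : complex1) (D : double_cover G).

Definition pdart (d : dart D) : dart G := (pedge d.1, d.2).

Lemma org_pdart d : org (pdart d) = pvert (org d).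
Proof. by case: d => e []; rewrite /org /= ?pvert_tgt ?pvert_src. Qed.

Lemma end_pdart d : end_ (pdart d) = pvert (end_ d).
Proof. by case: d => e []; rewrite /end_ /= ?pvert_tgt ?pvert_src. Qed.

Lemma pdart_flip d : pdart (flip d) = flip (pdart d).
Proof. by []. Qed.

Lemma pdart_inj d d' : org d = org d' -> pdart d = pdart d' -> d = d'.
Proof.
move=> oo pp; have [] := @star_lift _ D (org d) (pdart d); first exact: org_pdart.
by move=> x [_ U]; rewrite -(U d) // -(U d').
Qed.

Lemma pdart_lift (w : vert D) (d : dart G) : org d = pvert w ->
  exists2 d', org d' = w & pdart d' = d.
Proof. by move=> /star_lift[x [[ow px] _]]; exists x. Qed.

Lemma turn_pdart d d' : turn d d' -> turn (pdart d) (pdart d').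
Proof.
case/andP=> /eqP ed nd; rewrite /turn end_pdart org_pdart ed eqxx /=.
apply: contraNneq nd => E; apply/eqP/pdart_inj; first by rewrite org_flip.
by rewrite pdart_flip.
Qed.

Lemma walk_pdart u s v : walk u s v -> walk (pvert u) (map pdart s) (pvert v).
Proof.
elim: s u => [|d s IH] u /=; first by move=> /eqP->.
by case/andP=> /eqP<- /IH; rewrite org_pdart eqxx end_pdart.
Qed.

Lemma noback_pdart u s v : walk u s v -> noback s -> noback (map pdart s).
Proof.
case: s => // d s ws nb; have := walk_path u d s v; rewrite ws nb.
case/esym/and3P=> _ + _; rewrite /noback /=.
by elim: s d {ws nb} => //= d' s IH d /andP[/turn_pdart/andP[_ ->] /IH].
Qed.

Lemma tight_pdart q : tight q -> tight (map pdart q).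
Proof. by rewrite /tight cycle_map; apply: sub_cycle => d d' /turn_pdart. Qed.

Lemma loop_pdart (p : seq (dart D)) : is_loop p ->
  is_loop (map pdart (tighten p)) /\
  forall (R : realType) (f : edge G -> R),
    value (pullback f) p = value f (map pdart (tighten p)).
Proof.
case=> /tight_tighten/tight_pdart tq p0; split.
  by apply: tight_is_loop tq _; case: (tighten p) p0.
by move=> R f; rewrite /value (tighten_tight tq) big_map.
Qed.

Lemma forest_pdart (F : pred (edge G)) : forest F ->
  forest [pred e : edge D | F (pedge e)].
Proof.
move=> FF p lp; have [lq _] := loop_pdart lp; apply: contra (FF _ lq).
by move=> Fp; rewrite all_map; apply: (@all_tighten _ [pred d | F (pedge d.1)]).
Qed.

Lemma walk_lift (x : vert D) s v : walk (pvert x) s v ->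
  exists s' y, [/\ walk x s' y, pvert y = v & map pdart s' = s].
Proof.
elim: s x => [|d s IH] x /=; first by move/eqP=> <-; exists [::], x; rewrite /= eqxx.
case/andP=> /eqP /pdart_lift[d' od' pd']; rewrite -pd' end_pdart => /IH.
case=> s' [y [ws' py ps']]; exists (d' :: s'), y; split=> //=.
  by rewrite od' eqxx.
by rewrite pd' ps'.
Qed.

End Projection.

(** The double cover whose sheets are exchanged along the edges [e] such that
    [phi e]. *)
Section Cocycle.
Variables (G : complex1) (phi : edge G -> bool).

Definition dcov_complex : complex1 :=
  @Complex1 (vert G * bool)%type (edge G * bool)%type
    (fun e => (src e.1, e.2)) (fun e => (tgt e.1, e.2 (+) phi e.1)).

Lemma dcov_fibre2 (v : vert G) : #|[set w : vert dcov_complex | w.1 == v]%SET| = 2%N.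
Proof.
have -> : [set w : vert dcov_complex | w.1 == v]%SET = [set (v, true); (v, false)]%SET.
  by apply/setP => -[u b]; rewrite !inE /= !xpair_eqE; case: b; rewrite ?andbT ?andbF ?orbF.
by rewrite cards2 xpair_eqE eqxx.
Qed.

Lemma dcov_star_lift (w : vert dcov_complex) (d : dart G) : org d = w.1 ->
  exists! d' : dart dcov_complex, org d' = w /\ (d'.1.1, d'.2) = d.
Proof.
case: w d => [v b] [e []] /= <-.
  exists ((e, b (+) phi e), true); split; first by rewrite /org /= -addbA addbb addbF.
  case=> -[e' b'] c [] /= oE [eE cE]; move: oE; rewrite eE cE /org /= => E.
  have <- : b' (+) phi e = b := congr1 snd E.
  by rewrite -addbA addbb addbF.
exists ((e, b), false); split=> //.
case=> -[e' b'] c [] /= oE [eE cE]; move: oE; rewrite eE cE /org /= => E.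
by have <- : b' = b := congr1 snd E.
Qed.

Definition dcov : double_cover G :=
  @DoubleCover G dcov_complex fst fst (fun _ => erefl) (fun _ => erefl)
    dcov_fibre2 dcov_star_lift.

End Cocycle.

Lemma inj_surj_bijective (A : Type) (B : Type) (f : A -> B) :
  injective f -> (forall y, exists x, f x = y) -> bijective f.
Proof.
by move=> fi /choice[g gK]; exists g => // x; apply: fi; rewrite gK.
Qed.

(** Every double cover has this form: number the two vertices of each fibre;
    the two lifts of an edge both preserve the numbering or both change it. *)
Lemma exists_cocycle (G : complex1) (D : double_cover G) :
  exists phi, cover_iso D (dcov phi).
Proof.
have /choice[base pbase] : forall v, exists w : vert D, pvert w = v.
  move=> v; have: (0 < #|[set w : vert D | pvert w == v]%SET|)%N by rewrite fibre2.
  by case/card_gt0P=> w; rewrite inE => /eqP; exists w.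
pose lab (w : vert D) := w != base (pvert w).
have fvi : injective (fun w => (pvert w, lab w)).
  move=> w w' [pw]; rewrite /lab -pw.
  case: (w =P base (pvert w)) => [wb|/eqP nw] /=.
    by move/esym/negbFE/eqP=> ->.
  case: (w' =P base (pvert w)) => [//|/eqP nw'].
  move=> _; apply/eqP; apply: contraT => ww'.
  have: (#|[set base (pvert w); w; w']%SET| <= #|[set x : vert D | pvert x == pvert w]%SET|)%N.
    apply/subset_leq_card/fintype.subsetP => x; rewrite !inE.
    by case/orP=> [/orP[]|] /eqP->; rewrite ?pbase ?pw.
  by rewrite fibre2 finset.setUC cardsU1 cards2 !inE negb_or nw' [w' == w]eq_sym ww' eq_sym nw.
have fvs v b : exists w, (pvert w, lab w) = (v, b).
  case: b; last by exists (base v); rewrite /lab pbase eqxx.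
  have: (0 < #|[set w : vert D | pvert w == v] :\ base v|)%SET%N.
    have := cardsD1 (base v) [set w : vert D | pvert w == v]%SET.
    by rewrite fibre2 inE pbase eqxx; case: (#|_|).
  by case/card_gt0P=> w; rewrite !inE => /andP[nw /eqP pw]; exists w; rewrite /lab pw nw.
have src_inj (e e' : edge D) : src e = src e' -> pedge e = pedge e' -> e = e'.
  move=> se pe; have [] : (e, false) = (e', false) by apply: pdart_inj; rewrite /pdart /= ?pe.
  by [].
have tgt_inj (e e' : edge D) : tgt e = tgt e' -> pedge e = pedge e' -> e = e'.
  move=> se pe; have [] : (e, true) = (e', true) by apply: pdart_inj; rewrite /pdart /= ?pe.
  by [].
have lift_src e (w : vert D) : src e = pvert w -> exists2 e', src e' = w & pedge e' = e.
  by move=> /(@pdart_lift _ _ _ (e, false))[[e' b'] + [<- bE]]; rewrite bE; exists e'.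
have /choice[lft plft] : forall e, exists e' : edge D, pedge e' = e.
  move=> e; by have [e' _ pe] := lift_src e (base (src e)) (esym (pbase _)); exists e'.
pose phi e := lab (src (lft e)) (+) lab (tgt (lft e)).
have labE (e : edge D) : lab (tgt e) = lab (src e) (+) phi (pedge e).
  rewrite /phi; have [<-|ne] := eqVneq e (lft (pedge e)); first by rewrite addKb.
  have ns : lab (src e) <> lab (src (lft (pedge e))).
    move=> ls; move/eqP: ne; apply; apply: src_inj; last by rewrite plft.
    by apply: fvi; rewrite ls !pvert_src plft.
  have nt : lab (tgt e) <> lab (tgt (lft (pedge e))).
    move=> lt; move/eqP: ne; apply; apply: tgt_inj; last by rewrite plft.
    by apply: fvi; rewrite lt !pvert_tgt plft.
  by move: ns nt; do 4!case: (lab _).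
exists phi, (fun w => (pvert w, lab w)), (fun e => (pedge e, lab (src e))).
split=> //.
- by apply: inj_surj_bijective => // -[v b]; apply: fvs.
- apply: inj_surj_bijective => [e e' [pe ls]|[e b]].
    by apply: src_inj => //; apply: fvi; rewrite ls !pvert_src pe.
  have [w [pw lw]] := fvs (src e) b.
  by have [e' se pe] := lift_src e w (esym pw); exists e'; rewrite se pe lw.
- by move=> e; rewrite /= -labE pvert_src pvert_tgt.
Qed.

(** * Lifting words to double covers *)

Definition trivializes (G : complex1) (D : double_cover G) (phi : edge G -> bool)
    (lab : vert D -> bool) : Prop :=
  [/\ injective (fun w => (pvert w, lab w)),
      forall v b, exists w, pvert w = v /\ lab w = b
    & forall e : edge D, lab (tgt e) = lab (src e) (+) phi (pedge e)].

Lemma cover_iso_trivializes (G : complex1) (D : double_cover G) phi :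
  cover_iso D (dcov phi) -> exists lab : vert D -> bool, trivializes phi lab.
Proof.
case=> fv [fe [[gv gvK fvK] _ st pv pe]]; exists (fun w => (fv w).2).
have fvE w : fv w = (pvert w, (fv w).2) by rewrite -pv; case: (fv w).
split.
- move=> w w' [pw lw]; rewrite -[w]gvK -[w']gvK; congr gv.
  by rewrite fvE [RHS]fvE pw lw.
- by move=> v b; exists (gv (v, b)); rewrite fvK -pv fvK.
by move=> e; have [-> ->] := st e; rewrite -pe.
Qed.

Lemma dcov_trivializes (G : complex1) (phi : edge G -> bool) :
  trivializes phi (fun w : vert (dcov phi) => w.2).
Proof.
split=> //; first by case=> v b [v' b'] /= [-> ->].
by move=> v b; exists (v, b).
Qed.

Section Lift.
Variables (G : complex1) (D : double_cover G) (phi : edge G -> bool).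
Variable lab : vert D -> bool.
Hypothesis triv : trivializes phi lab.
Variable F : pred (edge G).
Hypotheses (forestF : forest F) (phiF : forall e, F e -> phi e = false).
Let FD : pred (edge D) := [pred e | F (pedge e)].

Lemma lab_dart (d : dart D) : lab (end_ d) = lab (org d) (+) phi (pedge d.1).
Proof.
case: triv => _ _ E; case: d => e []; rewrite /end_ /org /= E //.
by rewrite -addbA addbb addbF.
Qed.

Lemma lab_inF (x : vert D) s y : walk x s y -> inF FD s -> lab x = lab y.
Proof.
elim: s x => [|d s IH] x /=; first by move/eqP->.
by case/andP=> /eqP<- ws /andP[/phiF Fd /(IH _ ws)]; rewrite lab_dart Fd addbF.
Qed.

Lemma cc_down (x y : vert D) : cc FD x == cc FD y ->
  cc F (pvert x) == cc F (pvert y) /\ lab x = lab y.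
Proof.
case/cc_walk=> s [ws _ Fs]; split; last exact: lab_inF ws Fs.
by apply: walk_cc (walk_pdart ws) _; rewrite /inF all_map.
Qed.

Lemma cc_up (x : vert D) v : cc F (pvert x) == cc F v ->
  exists y, [/\ pvert y = v, lab y = lab x & cc FD x == cc FD y].
Proof.
case/cc_walk=> s [/walk_lift[s' [y [ws' py ps']]] _ Fs].
have Fs' : inF FD s' by move: Fs; rewrite -ps' /inF all_map.
by exists y; rewrite (lab_inF ws' Fs') (walk_cc ws' Fs').
Qed.

(** The lift of a word that starts each of its darts [d], labelled [b], on the
    sheet [b]. It visits each vertex of the collapsed cover at most once as soon
    as visits of the same vertex downstairs bear different labels. *)
Lemma lift_word (w : seq (dart G * bool)) : 
  cycle (fun x y => hturn F x.1 y.1 && (y.2 == x.2 (+) phi x.1.1)) w ->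
  uniq (map (fun x => (cc F (org x.1), x.2)) w) ->
  exists s : seq (dart D), [/\ cycle (hturn FD) s,
    uniq (map (fun d => cc FD (org d)) s), map (@pdart G D) s = map fst w &
    map (fun d => lab (org d)) s = map snd w].
Proof.
have [inj surj _] := triv.
have /choice[lift liftP] : forall x : dart G * bool, exists d : dart D,
    pdart d = x.1 /\ lab (org d) = x.2.
  case=> d b; have [u [pu lu]] := surj (org d) b.
  by have [d' od pd] := pdart_lift (esym pu); exists d'; rewrite od.
move=> cyc us; exists (map lift w); split.
- rewrite cycle_map; apply: sub_cycle cyc => x y /andP[/and4P[px py cxy nxy] /eqP yx].
  have [pdx lx] := liftP x; have [pdy ly] := liftP y.
  have pE d : pos FD d = pos F (pdart d) by [].
  rewrite /= /hturn !pE pdx pdy px py /=; apply/andP; split.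
    have [|z [pz lz cz]] := @cc_up (end_ (lift x)) (org y.1).
      by rewrite -end_pdart pdx.
    have <- // : z = org (lift y).
    apply: inj; rewrite pz lz -org_pdart pdy ly yx lab_dart lx.
    by have /(congr1 fst) /= -> := pdx.
  by apply: contraNneq nxy => E; rewrite -pdx -pdy E.
- rewrite -map_comp; rewrite map_inj_in_uniq.
    by apply: (@map_uniq _ _ (fun x => (cc F (org x.1), x.2))).
  move=> x y xw yw /= /eqP/cc_down; rewrite -!org_pdart.
  have [-> ->] := liftP x; have [-> ->] := liftP y => -[/eqP ccE lE].
  by apply: (map_uniq_inj us) => //=; rewrite ccE lE.
- by rewrite -map_comp; apply: eq_map => x /=; case: (liftP x).
- by rewrite -map_comp; apply: eq_map => x /=; case: (liftP x).
Qed.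

Lemma seg_pdart (R : realType) (f : edge G -> R) (d d' : dart D) : hturn FD d d' ->
  seg FD (pullback f) d d' = seg F f (pdart d) (pdart d').
Proof.
case/and4P=> _ _ /fillP[wz nz Fz] _; rewrite /seg; congr (_ + _).
rewrite end_pdart org_pdart (fill_uniq forestF (walk_pdart wz) (noback_pdart wz nz)).
  by rewrite big_map.
by rewrite /inF all_map.
Qed.

End Lift.

(** * The cover adapted to a word that visits no vertex three times *)

Section GoodWord.
Variables (G : complex1) (F : pred (edge G)).
Hypothesis connG : connected G.
Variables (x0 : dart G) (w : seq (dart G)).
Hypothesis cyc : cycle (hturn F) w.
Let n := size w.
Let cv (d : dart G) := cc F (org d).
Hypothesis twice : forall v, (count (fun d => cv d == v) w <= 2)%N.

Let W i := nth x0 w i.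
Let c i := cv (W i).
Let nx i := (i.+1 %% n)%N.

(** The first visit of a vertex takes place on the sheet [false], the second on
    the sheet [true]. *)
Let lab i : bool := c i \in take i (map cv w).

Let phi e : bool :=
  let i := index e (map fst w) in (i < n)%N && (lab i (+) lab (nx i)).

Lemma nx_lt i : (i < n)%N -> (nx i < n)%N.
Proof. by move=> i_n; rewrite ltn_pmod //; case: (n) i_n. Qed.

Lemma nx_inj i j : (i < n)%N -> (j < n)%N -> nx i = nx j -> i = j.
Proof.
move=> i_n j_n /eqP; rewrite /nx -addn1 -(addn1 j) eqn_modDr => /eqP.
by rewrite !modn_small.
Qed.

Lemma turn_nx i : (i < n)%N -> hturn F (W i) (W (nx i)).
Proof. by move=> i_n; apply: (elimT (cycle_nthP _ x0 _) cyc). Qed.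

Lemma c_nx i : (i < n)%N -> cc F (end_ (W i)) = c (nx i).
Proof. by move/turn_nx=> /and4P[_ _ /eqP]. Qed.

Lemma c_nth i : (i < n)%N -> nth (c 0) (map cv w) i = c i.
Proof. by move=> i_n; rewrite (nth_map x0). Qed.

(** As there is no third visit, one of the two is the first and the other one is
    not. *)
Lemma lab_neq i j : (i < n)%N -> (j < n)%N -> i <> j -> c i = c j -> lab i <> lab j.
Proof.
wlog ij : i j / (i < j)%N.
  move=> H i_n j_n /eqP; rewrite neq_ltn => /orP[] ij cij.
    by apply: H => //; lia.
  by move=> E; apply: (H j i) => //; lia.
move=> i_n j_n _ cij.
have labj : lab j.
  rewrite /lab -cij -c_nth // -(nth_take _ ij) mem_nth // size_take size_map.
  by rewrite -/n j_n.
rewrite labj => labi; have := twice (c i).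
have -> : count (fun d => cv d == c i) w = count_mem (c i) (map cv w).
  by rewrite count_map.
rewrite -(cat_take_drop i (map cv w)) count_cat (drop_nth (c 0)) ?size_map //.
rewrite c_nth //= eqxx.
have : (0 < count_mem (c i) (take i (map cv w)))%N by rewrite -has_count has_pred1.
have : (0 < count_mem (c i) (drop i.+1 (map cv w)))%N.
  rewrite -has_count has_pred1 cij -c_nth //.
  have -> : nth (c 0) (map cv w) j = nth (c 0) (drop i.+1 (map cv w)) (j - i.+1).
    by rewrite nth_drop; congr nth; lia.
  by rewrite mem_nth // size_drop size_map -/n; lia.
by move: (count _ _) (count _ _) => [|?] [|?]; rewrite ?addnS.
Qed.

(** [phi] is read off at the first passage over an edge. It fits a second
    passage too: then both ends are visited twice, with opposite labels, and the
    changes of label along both passages agree. *)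
Lemma phi_edge i : (i < n)%N -> phi (W i).1 = lab i (+) lab (nx i).
Proof.
move=> j_n; rewrite /phi; set j := i in j_n *; set k := index _ _.
have k_n : (k < n)%N by rewrite /n -(size_map fst) index_mem map_f ?mem_nth.
rewrite k_n /=; have Ekj : (W k).1 = (W j).1.
  have := @nth_index _ (W j).1 (W j).1 (map fst w).
  by rewrite (nth_map x0) // => -> //; rewrite map_f ?mem_nth.
have [->//|kj] := eqVneq k j.
have ckn := c_nx k_n; have cjn := c_nx j_n.
have nkj : nx k <> nx j by move/(nx_inj k_n j_n)/eqP; apply/negP.
have [E|E] : W j = W k \/ W j = flip (W k).
  move: Ekj; case: (W k) => e b; case: (W j) => e' b' /= ->; rewrite /flip /=.
  by case: b; case: b'; auto.
- have l1 := @lab_neq k j k_n j_n (elimN eqP kj).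
  have l2 := lab_neq (nx_lt k_n) (nx_lt j_n) nkj.
  move: l1 l2; rewrite -ckn -cjn /c E => /(_ erefl) + /(_ erefl).
  by do 4!case: (lab _).
have jnk : j <> nx k.
  move=> jk; have := turn_nx k_n; rewrite -jk E => /and4P[_ _ _].
  by rewrite eqxx.
have knj : k <> nx j.
  move=> jk; have := turn_nx j_n; rewrite -jk E => /and4P[_ _ _].
  by rewrite flipK eqxx.
have l1 := lab_neq j_n (nx_lt k_n) jnk; have l2 := lab_neq k_n (nx_lt j_n) knj.
move: l1 l2; rewrite -ckn -cjn /c /cv E org_flip end_flip => /(_ erefl) + /(_ erefl).
by do 4!case: (lab _).
Qed.

Lemma phi_F e : F e -> phi e = false.
Proof.
move=> Fe; rewrite /phi; set i := index _ _; case: ltnP => //= i_n.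
have /mapP[d dw de] : e \in map fst w by rewrite -index_mem size_map.
by have := next_cycle cyc dw; rewrite /hturn /pos -de Fe.
Qed.

Let lw := mkseq (fun i => (W i, lab i)) n.

Lemma good_labels :
  [/\ map fst lw = w,
      cycle (fun x y => hturn F x.1 y.1 && (y.2 == x.2 (+) phi x.1.1)) lw &
      uniq (map (fun x => (cc F (org x.1), x.2)) lw)].
Proof.
split.
- by rewrite /lw /mkseq -map_comp map_nth_iota0 // take_size.
- apply/(cycle_nthP _ (x0, false)); rewrite size_mkseq => i i_n.
  rewrite -/(nx i) !nth_mkseq ?nx_lt //= turn_nx //= phi_edge //.
  by rewrite addKb.
rewrite /lw /mkseq -map_comp.
apply/(@mkseq_uniqP _ _ _) => i j; rewrite !inE => i_n j_n /= [cij lij].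
by apply: contrapT => /lab_neq; apply.
Qed.

(** The lift of the word joins the two points of the fibre over a vertex that
    it visits twice. *)
Lemma good_connected : ~~ uniq (map cv w) -> connected (dcov phi).
Proof.
case/(uniqPn (c 0)) => i [j [ij]]; rewrite size_map => j_n.
have i_n : (i < n)%N := ltn_trans ij j_n.
rewrite !c_nth // => cij; have [ew cyclw ulw] := good_labels.
have triv := dcov_trivializes phi.
have [s [cycs us ps ls]] := lift_word triv phi_F cyclw ulw.
pose FD : pred (edge (dcov phi)) := [pred e | F (pedge e)].
pose T (u : vert (dcov phi)) := cc predT u.
have Twalk u t v : walk u t v -> T u = T v.
  by move=> wt; apply/eqP/(walk_cc wt); rewrite /inF all_predT.
have Tcc u v : cc FD u == cc FD v -> T u = T v by case/cc_walk=> t [/Twalk].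
have Tturn x y : hturn FD x y -> T (org x) = T (org y).
  case/and4P=> _ _ /Tcc <- _; apply: (@Twalk _ [:: x]).
  by rewrite /= !eqxx.
have Tpath x t : path (hturn FD) x t -> forall y, y \in t -> T (org y) = T (org x).
  elim: t x => // z t IH x /= /andP[/Tturn xz /IH zt] y; rewrite inE xz.
  by case/orP=> [/eqP->//|/zt].
have Ts x y : x \in s -> y \in s -> T (org x) = T (org y).
  case: (s) cycs => // z t cyct xs ys.
  by rewrite !(Tpath z _ cyct) // mem_rcons.
have sz : size s = n by rewrite -(size_map (@pdart G (dcov phi))) ps ew.
pose d0 : dart (dcov phi) := ((x0.1, false), false).
pose a := org (nth d0 s i); pose b := org (nth d0 s j).
have Tab : T a = T b by apply: Ts; rewrite mem_nth ?sz.
have pa k : (k < n)%N -> pvert (org (nth d0 s k)) = org (W k) /\ (org (nth d0 s k)).2 = lab k.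
  move=> k_n; split.
    rewrite -org_pdart -(nth_map _ x0) ?sz // ps ew //.
  have := congr1 (fun r => nth false r k) ls; rewrite (nth_map d0) ?sz // => ->.
  by rewrite /lw /mkseq -map_comp (nth_map 0%N) ?size_iota // nth_iota.
have [pai lai] := pa i i_n; have [pbj lbj] := pa j j_n.
have [|y [py ly cay]] := @cc_up _ _ _ _ triv F phi_F a (pvert b).
  by rewrite pai pbj; apply/eqP.
have Ty : T y = T b by rewrite -Tab; apply/esym/Tcc.
have Tall x : T x = T b.
  have [_ wG] := (connectedP G).1 connG.
  have [t /walk_lift[t' [z [/Twalk -> pz _]]]] := wG (pvert x) (pvert b).
  have [<-//|nzb] := eqVneq z b.
  rewrite -Ty; congr T; have [injT _ _] := triv; apply: (injT).
  rewrite pz py; congr pair; rewrite ly lai.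
  have zb : z.2 <> b.2.
    by move=> E; move/eqP: nzb; apply; apply: (injT); rewrite pz E.
  have := lab_neq i_n j_n (elimN eqP (negbT (ltn_eqF ij))) cij.
  by move: zb; rewrite lbj; case: (z.2); case: (lab i); case: (lab j).
apply/connectedP; split; first by apply/card_gt0P; exists b.
move=> u v; have /eqP/cc_walk[t [wt _ _]] : T u = T v by rewrite !Tall.
by exists t.
Qed.

End GoodWord.

Lemma adapted_cover (G : complex1) (F : pred (edge G)) (w : seq (dart G)) :
  connected G -> cycle (hturn F) w ->
  (forall v, (count (fun d => cc F (org d) == v) w <= 2)%N) ->
  ~~ uniq (map (fun d => cc F (org d)) w) ->
  exists phi : edge G -> bool, exists lw : seq (dart G * bool),
  [/\ forall e, F e -> phi e = false, connected (dcov phi), map fst lw = w,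
      cycle (fun x y => hturn F x.1 y.1 && (y.2 == x.2 (+) phi x.1.1)) lw &
      uniq (map (fun x => (cc F (org x.1), x.2)) lw)].
Proof.
case: w => // x0 w connG cyc twice nu.
have [ew cyclw ulw] := good_labels x0 cyc twice.
by eexists; eexists; split;
  [exact: (phi_F x0 cyc) | exact: (good_connected connG x0 cyc twice nu)
  | exact: ew | exact: cyclw | exact: ulw].
Qed.

Lemma cycle_double (T : Type) (e : rel T) w : cycle e w -> cycle e (w ++ w).
Proof.
case: w => //= x t pt; rewrite rcons_cat rcons_cons -cat_rcons cat_path last_rcons.
by rewrite pt.
Qed.

Lemma csum_double (R : realType) (T : Type) (k : T -> T -> R) w :
  csum k (w ++ w) = 2 * csum k w.
Proof.
case: w => [|x t]; first by rewrite /= mulr0.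
rewrite /csum /= rcons_cat rcons_cons -cat_rcons psum_cat last_rcons.
by rewrite -mulr2n mulr_natl.
Qed.

(** The word lifts to a simple one in the adapted cover, whose class gives one
    term of the correction. If it visits no vertex twice, its lift does not join
    the two sheets, so it is run through twice; whence the factor [m]. *)
Lemma good_class (R : realType) (G : complex1) (I : finType)
    (C : I -> double_cover G) (l : edge G -> R) :
  connected G -> all_double_covers C -> (forall e, 0 <= l e) ->
  let F := [pred e | l e == 0] in forest F ->
  forall w, w <> [::] -> cycle (hturn F) w ->
  (forall v, (count (fun d => cc F (org d) == v) w <= 2)%N) ->
  exists i a (m : R), [/\ 0 < m, a \in H1_2 (C i), a != 0,
    min_length (pullback (C := C i) l) a = m * \sum_(d <- w) l d.1 &
    forall tau : edge G -> R,
      max_realizing (pullback (C := C i) l) (pullback (C := C i) tau) a =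
      m * csum (seg F tau) w].
Proof.
move=> connG hC l0 F forestF w w0 cyc twice.
wlog nu : w w0 cyc twice / ~~ uniq (map (fun d => cc F (org d)) w).
  move=> H; have [uw|nu] := boolP (uniq (map (fun d => cc F (org d)) w)); last exact: H.
  have [||v||i [a [m [m0 aH a0 len val]]]] := H (w ++ w).
  - by case: (w) w0.
  - exact: cycle_double.
  - have : (count (fun d => cc F (org d) == v) w <= 1)%N.
      have -> : count (fun d => cc F (org d) == v) w =
          count_mem v (map (fun d => cc F (org d)) w) by rewrite count_map.
      by rewrite count_uniq_mem // leq_b1.
    by rewrite count_cat; lia.
  - rewrite map_cat cat_uniq; case: (w) w0 => //= d t _.
    by rewrite mem_head /= andbF.
  exists i, a, (m * 2); split=> //.
  - by rewrite mulr_gt0.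
  - by rewrite len big_cat /= -mulrA mulr2n mulrDl mul1r.
  - by move=> tau; rewrite val csum_double mulrA.
have [phi [lw [phiF conn ew cyclw ulw]]] := adapted_cover connG cyc twice nu.
have [i [isoi _]] := hC.2 _ conn.
have [lab triv] := cover_iso_trivializes isoi.
have [s [cycs us ps _]] := lift_word triv phiF cyclw ulw.
have s0 : s <> [::] by move=> s0; apply: w0; rewrite -ew -ps s0.
have [a [aH a0 len val]] :=
  simple_word (l := pullback l) (fun e => l0 _) (forest_pdart forestF) s0 cycs us.
exists i, a, 1; split=> //.
- by rewrite mul1r len -ew -ps big_map.
move=> tau; rewrite mul1r val -ew -ps.
by apply: csum_map cycs => x y; apply: seg_pdart.
Qed.

(** * Counting covers and classes *)

Section Rank.
Variables (F : fieldType) (X : complex1).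
Hypothesis connX : connected X.
Let B := boundary F X.

Lemma coboundaryE (x : 'rV[F]_#|vert X|) i :
  (x *m B^T) 0 i = x 0 (enum_rank (tgt (enum_val i))) - x 0 (enum_rank (src (enum_val i))).
Proof.
have pick (u : vert X) : \sum_j x 0 j * (u == enum_val j)%:R = x 0 (enum_rank u).
  rewrite (bigD1 (enum_rank u)) //= enum_rankK eqxx mulr1 big1 ?addr0 // => j nj.
  rewrite (_ : _ == _ = false) ?mulr0 //.
  by apply: contraNF nj => /eqP->; rewrite enum_valK.
rewrite mxE -!pick -sumrB; apply: eq_bigr => j _.
by rewrite !mxE mulrBr.
Qed.

(** The functions on the vertices with zero coboundary are constant. *)
Lemma rank_boundary : (\rank B).+1 = #|vert X|.
Proof.
have [X0 cX] := (connectedP X).1 connX.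
pose one : 'rV[F]_#|vert X| := const_mx 1.
have one0 : one != 0.
  apply/eqP => /rowP/(_ (Ordinal X0)); rewrite !mxE; apply/eqP; exact: oner_neq0.
have kerE : (kermx B^T == one)%MS.
  apply/andP; split; last first.
    by apply/sub_kermxP/rowP => i; rewrite coboundaryE !mxE subrr.
  apply/row_subP => k; set x := row k _.
  have x0 : x *m B^T = 0 by apply/sub_kermxP; exact: row_sub.
  have cst u v : x 0 (enum_rank u) = x 0 (enum_rank v).
    have [s] := cX u v; elim: s u => [|[e b] s IH] u /=; first by move/eqP->.
    case/andP=> /eqP<- /IH <-.
    have /rowP/(_ (enum_rank e)) := x0; rewrite coboundaryE [RHS]mxE enum_rankK.
    by move/eqP; rewrite subr_eq0 => /eqP; rewrite /org /end_ /=; case: b.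
  apply/sub_rVP; exists (x 0 (Ordinal X0)); apply/rowP => j.
  rewrite !mxE mulr1 -[j]enum_valK -[Ordinal X0]enum_valK.
  by have := cst (enum_val j) (enum_val (Ordinal X0)); rewrite /x !mxE.
have : \rank (kermx B^T) = 1%N by rewrite (eqmxP kerE) rank_rV one0.
rewrite mxrank_ker mxrank_tr.
by have := rank_leq_col B; lia.
Qed.

Lemma rank_cycles : (\rank (kermx B) + #|vert X|)%N = #|edge X|.+1.
Proof.
by rewrite mxrank_ker; have := rank_leq_row B; have := rank_boundary; lia.
Qed.

(** A cochain that vanishes on all cycles is a coboundary, by a comparison of
    dimensions. *)
Lemma coboundaryP (r : 'rV[F]_#|edge X|) : r *m (kermx B)^T = 0 ->
  exists x, r = x *m B^T.
Proof.
move=> r0; apply/submxP.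
have sub : (B^T <= kermx (kermx B)^T)%MS.
  by apply/sub_kermxP; rewrite -trmx_mul mulmx_ker trmx0.
have /eqmxP/eqmxP E : (B^T == kermx (kermx B)^T)%MS.
  rewrite -(geq_leqif (mxrank_leqif_eq sub)) mxrank_ker !mxrank_tr mxrank_ker.
  by have := rank_leq_row B; lia.
by rewrite (eqmxP E); apply/sub_kermxP.
Qed.

End Rank.

Lemma card_H1 (X : complex1) :
  (#|H1_2 X| <= 2 ^ \rank (kermx (boundary 'F_2 X)))%N.
Proof.
set K := kermx _.
have sub : H1_2 X \subset [set c *m row_base K | c : 'rV['F_2]_(\rank K)]%SET.
  apply/fintype.subsetP => a; rewrite inE => /eqP/sub_kermxP.
  rewrite -(eq_row_base (kermx _)) => /submxP[c ->].
  by apply: imset_f.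
apply: leq_trans (subset_leq_card sub) _; apply: leq_trans (leq_imset_card _ _) _.
by rewrite card_mx card_Fp // mul1n.
Qed.

Section Isomorphisms.
Variables (G : complex1) (D : double_cover G).
Implicit Types phi : edge G -> bool.

Lemma cover_iso_card phi : cover_iso D (dcov phi) ->
  #|vert D| = (2 * #|vert G|)%N /\ #|edge D| = (2 * #|edge G|)%N.
Proof.
case=> fv [fe [bv be _ _ _]].
by rewrite (bij_eq_card bv) (bij_eq_card be) /= !card_prod card_bool !(mulnC 2).
Qed.

Lemma cover_iso_connected phi : cover_iso D (dcov phi) ->
  connected D -> connected (dcov phi).
Proof.
case=> fv [fe [[gv gvK fvK] _ st _ _]] /connectedP[D0 cD]; apply/connectedP; split.
  by case/card_gt0P: D0 => w _; apply/card_gt0P; exists (fv w).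
move=> u v; have [s ws] := cD (gv u) (gv v).
exists (map (fun d => (fe d.1, d.2)) s); rewrite -[u]fvK -[v]fvK.
have oE d : @org (dcov phi) (fe d.1, d.2) = fv (org d).
  by have [s1 s2] := st d.1; case: d s1 s2 => e [].
have eE d : @end_ (dcov phi) (fe d.1, d.2) = fv (end_ d).
  by have [s1 s2] := st d.1; case: d s1 s2 => e [].
elim: s (gv u) ws => [|d s IH] x; first by move=> /= /eqP->.
rewrite [walk _ _ _]/= => /andP[/eqP<- /IH ws].
by rewrite [walk _ _ _]/=; apply/andP; split; [apply/eqP/oE | rewrite eE].
Qed.

(** Renumbering the fibres changes the cocycle by a coboundary. *)
Lemma cover_iso_shift phi phi' (y : vert G -> bool) : cover_iso D (dcov phi) ->
  (forall e, phi' e = phi e (+) y (src e) (+) y (tgt e)) -> cover_iso D (dcov phi').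
Proof.
case=> fv [fe [bv be st pv pe]] E.
pose sv (v : vert G * bool) := (v.1, v.2 (+) y v.1).
pose se (e : edge G * bool) := (e.1, e.2 (+) y (src e.1)).
exists (sv \o fv), (se \o fe); split.
- apply: bij_comp => //; apply: inv_bij => -[v b].
  by rewrite /sv /= -addbA addbb addbF.
- apply: bij_comp => //; apply: inv_bij => -[e b].
  by rewrite /se /= -addbA addbb addbF.
- move=> e; have [/= -> ->] := st e; rewrite /sv /se /=; split=> //.
  congr pair; rewrite E; case: (fe e) => e' b /=.
  by case: b; case: (phi _); case: (y _); case: (y _).
- by move=> w; rewrite -pv.
- by move=> e; rewrite -pe.
Qed.

End Isomorphisms.

Lemma F2_bool (x : 'F_2) : x = (x != 0)%:R.
Proof. by case: x => -[|[|]] // i; apply/val_inj. Qed.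

Section Count.
Variables (G : complex1) (n : nat) (I : finType) (C : I -> double_cover G).
Hypotheses (connG : connected G) (rankG : graph_rank G = n).
Hypothesis hC : all_double_covers C.

Lemma rank_G : (n + #|vert G|)%N = #|edge G|.+1.
Proof. by rewrite -rankG rank_cycles. Qed.

(** Both the edges and the vertices double in number, so the rank [n] becomes
    [2 * n - 1]. *)
Lemma count_classes i : (#|[set a in H1_2 (C i) | a != 0%R]%SET| <= 2 ^ (2 * n - 1) - 1)%N.
Proof.
have [phi iso] := exists_cocycle (C i); have [eV eE] := cover_iso_card iso.
have rk : \rank (kermx (boundary 'F_2 (C i))) = (2 * n - 1)%N.
  have := rank_cycles 'F_2 (hC.1 i); have := rank_G; have [G0 _] := connG.
  by move: (\rank _) => k; lia.
have := card_H1 (C i); rewrite rk (cardsD1 (0 : 'rV_#|edge (C i)|)) inE mul0mx eqxx => H.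
have -> : [set a in H1_2 (C i) | a != 0]%SET = (H1_2 (C i) :\ (0 : 'rV_#|edge (C i)|))%SET.
  by apply/setP => a; rewrite !inE andbC.
by move: H; set u := #|_|; lia.
Qed.

(** A connected double cover is determined by the values of its cocycle on the
    cycles, which are not all zero. *)
Lemma count_covers : (#|I| <= 2 ^ n - 1)%N.
Proof.
have /choice[phi iso] : forall i, exists phi, cover_iso (C i) (dcov phi).
  by move=> i; apply: exists_cocycle.
set K := kermx (boundary 'F_2 G).
have rK : \rank K = n.
  by have := rank_cycles 'F_2 connG; have := rank_G; rewrite -/K; lia.
pose r i : 'rV['F_2]_#|edge G| := \row_j (phi i (enum_val j))%:R.
pose code i := r i *m (row_base K)^T.
have cob (s : 'rV['F_2]_#|edge G|) : s *m (row_base K)^T = 0 ->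
    exists y : vert G -> bool, forall e,
      s 0 (enum_rank e) = (y (src e) (+) y (tgt e))%:R.
  move=> s0; have [|x sx] := @coboundaryP 'F_2 G s.
    have /submxP[M ->] : (kermx (boundary 'F_2 G) <= row_base K)%MS by rewrite eq_row_base.
    by rewrite trmx_mul mulmxA s0 mul0mx.
  exists (fun v => x 0 (enum_rank v) != 0) => e.
  rewrite sx coboundaryE enum_rankK.
  rewrite {1}[x 0 (enum_rank (tgt e))]F2_bool {1}[x 0 (enum_rank (src e))]F2_bool.
  by case: (_ != 0); case: (_ != 0); apply/eqP.
have code_inj : injective code.
  move=> i j E; have [|y ye] := cob (r i - r j); first by rewrite mulmxBl -/(code i) E subrr.
  have isoij : cover_iso (C i) (dcov (phi j)).
    apply: (cover_iso_shift (y := y) (iso i)) => e; have := ye e.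
    rewrite !mxE enum_rankK.
    case: (phi i e); case: (phi j e); case: (y _); case: (y _) => //= /eqP //.
  have [k [_ uk]] := hC.2 _ (cover_iso_connected (iso j) (hC.1 j)).
  by rewrite -(uk i isoij) -(uk j (iso j)).
have code0 i : code i != 0.
  apply/eqP => /cob[y ye].
  have iso0 : cover_iso (C i) (dcov (fun _ => false)).
    apply: (cover_iso_shift (y := y) (iso i)) => e; have := ye e.
    rewrite !mxE enum_rankK.
    by case: (phi i e); case: (y _); case: (y _) => //= /eqP.
  have [lab triv] := cover_iso_trivializes iso0; have [_ surj _] := triv.
  have [_ cD] := (connectedP (C i)).1 (hC.1 i).
  have [/card_gt0P[v _] _] := connG.
  have [w [_ lw]] := surj v true; have [w' [_ lw']] := surj v false.
  have [s ws] := cD w w'.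
  have := @lab_inF _ _ _ _ triv predT (fun _ _ => erefl) w s w' ws.
  by rewrite lw lw' /inF all_predT => /(_ isT).
have -> : (2 ^ n - 1)%N = #|[set~ (0 : 'rV['F_2]_(\rank K))]%SET|.
  by rewrite cardsC1 card_mx card_Fp // mul1n rK subn1.
rewrite -cardsT -(card_imset _ code_inj); apply/subset_leq_card/fintype.subsetP => c.
by case/imsetP=> i _ ->; rewrite !inE.
Qed.

End Count.

(** * The Lipschitz norm and the correction term *)

Section CsumOrder.
Variables (R : realType) (T : Type) (e : rel T).
Implicit Types (k : T -> T -> R) (s : seq T).

Lemma csum_le k k' s : (forall x y, e x y -> k x y <= k' x y) -> cycle e s ->
  csum k s <= csum k' s.
Proof.
move=> kk; case: s => //= x s; move: (rcons s x) => t.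
by elim: t x => //= y t IH x /andP[/kk h /IH]; apply: lerD.
Qed.

Lemma csum_scale k (b : R) s : csum (fun x y => b * k x y) s = b * csum k s.
Proof.
case: s => [|x s] /=; first by rewrite mulr0.
move: (rcons s x) => t; elim: t x => [|y t IH] x /=; first by rewrite mulr0.
by rewrite IH mulrDr.
Qed.

Lemma csum_lin k k' (b : R) s :
  csum (fun x y => k x y + b * k' x y) s = csum k s + b * csum k' s.
Proof.
case: s => [|x s] /=; first by rewrite mulr0 addr0.
move: (rcons s x) => t; elim: t x => [|y t IH] x /=; first by rewrite mulr0 addr0.
by rewrite IH; ring.
Qed.

Lemma csum_node (g : T -> R) s : csum (fun _ y => g y) s = \sum_(x <- s) g x.
Proof.
case: s => [|x s]; first by rewrite big_nil.
have E z t : psum (fun _ y => g y) z t = \sum_(y <- t) g y.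
  by elim: t z => [|y t IH] z /=; rewrite ?big_nil // big_cons IH.
by rewrite csum_cons E big_cons addrC.
Qed.

End CsumOrder.

Section Norm.
Variables (R : realType) (G : complex1) (l : edge G -> R).
Hypothesis l_ge0 : forall e, 0 <= l e.
Let F : pred (edge G) := [pred e | l e == 0].
Hypothesis forestF : forest F.
Implicit Types (f : edge G -> R) (q : seq (dart G)).

Lemma seg_lin f g (b : R) d d' :
  seg F (fun e => f e + b * g e) d d' = seg F f d d' + b * seg F g d d'.
Proof. by rewrite /seg big_split -mulr_sumr /=; ring. Qed.

Lemma seg_len d d' : hturn F d d' -> seg F l d d' = l d'.1.
Proof.
case/and4P=> _ _ /fillP[_ _ /allP Fz] _; rewrite /seg big_seq big1 ?add0r //.
by move=> d1 /Fz /eqP.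
Qed.

Lemma csum_seg_len s : cycle (hturn F) s -> csum (seg F l) s = \sum_(d <- s) l d.1.
Proof.
move=> cyc; rewrite -(csum_node (fun d : dart G => l d.1)).
by apply/eqP; rewrite eq_le; apply/andP; split; apply: csum_le cyc => x y /seg_len->.
Qed.

Lemma len_gt0 q : tight q -> q <> [::] -> 0 < \sum_(d <- q) l d.1.
Proof.
move=> tq q0; have [x xq px] := tight_pos forestF tq q0.
rewrite (big_rem x) //= ltr_pwDl ?sumr_ge0 // lt_neqAle l_ge0 eq_sym andbT.
exact: px.
Qed.

(** There are finitely many turns in the collapsed graph, and each takes a
    positive length. *)
Lemma ratio_bounded f : exists B, forall q, tight q -> q <> [::] ->
  \sum_(d <- q) f d.1 <= B * \sum_(d <- q) l d.1.
Proof.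
pose t (x y : dart G) := `|seg F f x y| / l y.1.
have t0 x y : 0 <= t x y by rewrite divr_ge0.
pose B := \sum_x \sum_y t x y.
exists B => q tq q0; have [x xq px] := tight_pos forestF tq q0.
have [s [_ cyc E]] := @collapse_tight R G F forestF q x tq xq px.
rewrite !E -csum_scale; apply: csum_le cyc => y z h; rewrite seg_len //.
have lz : 0 < l z.1.
  by rewrite lt_neqAle l_ge0 eq_sym andbT; case/and4P: h.
rewrite -ler_pdivrMr //; apply: (@le_trans _ _ (t y z)).
  by rewrite /t ler_wpM2r ?invr_ge0 // ler_norm.
rewrite /B (bigD1 y) //= (bigD1 z) //= -addrA lerDl addr_ge0 ?sumr_ge0 //.
by move=> i _; apply: sumr_ge0.
Qed.

Lemma le_normL f q : tight q -> q <> [::] ->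
  \sum_(d <- q) f d.1 <= normL l f * \sum_(d <- q) l d.1.
Proof.
move=> tq q0; rewrite -ler_pdivrMr ?len_gt0 //; apply: ub_le_sup; last first.
  by exists q; [exact: tight_is_loop | rewrite /value tighten_tight].
have [B HB] := ratio_bounded f; exists B => _ [p [cp p0] <-].
by rewrite ler_pdivrMr ?len_gt0 ?HB //; exact: tight_tighten.
Qed.

Lemma normL_le f c : (exists2 q : seq (dart G), tight q & q <> [::]) ->
  (forall q, tight q -> q <> [::] ->
     \sum_(d <- q) f d.1 <= c * \sum_(d <- q) l d.1) ->
  normL l f <= c.
Proof.
case=> q tq q0 H; apply: ge_sup.
  by exists (value f q / value l q), q => //; exact: tight_is_loop.
move=> _ [p [cp p0] <-].
by rewrite ler_pdivrMr ?len_gt0 ?H //; exact: tight_tighten.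
Qed.

Lemma value_le_normL f p : is_loop p -> value f p <= normL l f * value l p.
Proof. by case=> cp p0; apply: le_normL => //; apply: tight_tighten. Qed.

End Norm.

(** The values [sup A = 0] and [inf A = 0] where no supremum or infimum exists
    obey these bounds too. *)
Section SupBounds.
Variable R : realType.
Implicit Types (A : set R) (c : R).

Lemma inf_ge0 A : (forall x, A x -> 0 <= x) -> 0 <= inf A.
Proof.
move=> H; have [->|/set0P A0] := eqVneq A set0; first by rewrite inf0.
exact: lb_le_inf.
Qed.

Lemma sup_le A c : (forall x, A x -> x <= c) -> 0 <= c -> sup A <= c.
Proof.
move=> H c0; have [->|/set0P A0] := eqVneq A set0; first by rewrite sup0.
exact: ge_sup.
Qed.

Lemma le_sup A c : (forall x, A x -> c <= x) -> c <= 0 -> c <= sup A.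
Proof.
move=> H c0; have [|nA] := pselect (has_sup A); last by rewrite sup_out.
by case=> -[x Ax] uA; apply: le_trans (H _ Ax) _; apply: ub_le_sup.
Qed.

End SupBounds.

Section Terms.
Variables (R : realType) (X : complex1) (l : edge X -> R) (B : R).
Hypotheses (l_ge0 : forall e, 0 <= l e) (B_ge0 : 0 <= B).
Implicit Types (f : edge X -> R) (a : 'rV['F_2]_#|edge X|).

Lemma min_length_ge0 a : 0 <= min_length l a.
Proof. by apply: inf_ge0 => _ [p _ <-]; apply: sumr_ge0. Qed.

Lemma term_le f a : (forall p, is_loop p -> value f p <= B * value l p) ->
  max_realizing l f a / min_length l a <= B.
Proof.
move=> H; have [->|m0] := eqVneq (min_length l a) 0; first by rewrite invr0 mulr0.
have m_gt0 : 0 < min_length l a by rewrite lt_neqAle eq_sym m0 min_length_ge0.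
rewrite ler_pdivrMr //; apply: sup_le; last by rewrite mulr_ge0 // ltW.
by move=> _ [p [[lp _] <-] <-]; apply: H.
Qed.

Lemma term_ge f a : (forall p, is_loop p -> - value f p <= B * value l p) ->
  - B <= max_realizing l f a / min_length l a.
Proof.
move=> H; have [->|m0] := eqVneq (min_length l a) 0.
  by rewrite invr0 mulr0 oppr_le0.
have m_gt0 : 0 < min_length l a by rewrite lt_neqAle eq_sym m0 min_length_ge0.
rewrite ler_pdivlMr // mulNr; apply: le_sup; last by rewrite oppr_le0 mulr_ge0 // ltW.
by move=> _ [p [[lp _] <-] <-]; rewrite lerNl H.
Qed.

End Terms.

Section Final.
Variables (R : realType) (G : complex1) (n : nat).
Hypotheses (hG : is_graph G) (hrank : graph_rank G = n).
Variables (I : finType) (C : I -> double_cover G) (l tau : edge G -> R).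
Hypotheses (hC : all_double_covers C) (hl : is_metric l) (htau : is_tangent tau).
Let F : pred (edge G) := [pred e | l e == 0].
Let mtau e := - tau e.
Let L' := normL l mtau.
Let tau' e := tau e + L' * l e.
Let T f i a := max_realizing (pullback (C := C i) l) (pullback (C := C i) f) a /
               min_length (pullback (C := C i) l) a.
Let K := ((2 ^ n - 1) * (2 ^ (2 * n - 1) - 1))%N.

Lemma l_ge0 e : 0 <= l e.
Proof. by case: hl => /(_ e)/andP[]. Qed.

Lemma forestF : forest F. Proof. by case: hl. Qed.

Lemma value_opp (X : complex1) (f : edge X -> R) p :
  value (fun e => - f e) p = - value f p.
Proof. by rewrite /value sumrN. Qed.

Lemma tau'_ge0 q : tight q -> 0 <= \sum_(d <- q) tau' d.1.
Proof.
move=> tq; have [->|/eqP q0] := eqVneq q [::]; first by rewrite big_nil.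
have := le_normL l_ge0 forestF mtau tq q0.
by rewrite -/L' sumrN /tau' big_split -mulr_sumr /= addrC -subr_ge0 opprK.
Qed.

Lemma exists_tight : exists2 q : seq (dart G), tight q & q <> [::].
Proof.
have [[G0 _] val] := hG.
have [sigma si st] := exists_turn_perm (fun v => ltnW (val v)).
have [v _] := card_gt0P G0.
have [d _] := card_gt0P (ltnW (ltnW (val v))).
exists (fingraph.orbit sigma d).
  by apply: sub_cycle (cycle_orbit si d) => x y /eqP <-; apply: st.
by move=> E; have := in_orbit sigma d; rewrite E.
Qed.

(** The metric has total length one and [tau] has total zero, so [L'] is half
    the sum of [tau'] over all darts. Their cyclic order around the vertices
    splits them into immersed closed paths. *)
Lemma L'_ge0 (pi : dart G -> R) :
  (forall d d', turn d d' -> 0 <= tau' d'.1 + pi d - pi d') -> 0 <= L'.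
Proof.
move=> pot; have [[G0 _] val] := hG.
have [sigma si st] := exists_turn_perm (fun v => ltnW (val v)).
have: 0 <= \sum_(d : dart G) (tau' (sigma d).1 + pi d - pi (sigma d)).
  by apply: sumr_ge0 => d _; apply: pot.
have re (g : dart G -> R) : \sum_d g (sigma d) = \sum_d g d.
  by rewrite [RHS](reindex_inj si).
rewrite sumrB big_split /= (re (fun d => tau' d.1)) (re pi) addrK.
rewrite -(pair_bigA _ (fun e (b : bool) => tau' e)) /=.
under eq_bigr => e _ do rewrite sumr_const card_bool.
have [_ l1 _] := hl.
rewrite sumrMnl /tau' big_split -mulr_sumr l1 /= (htau : \sum_e tau e = 0).
by rewrite add0r mulr1 pmulrn_lge0.
Qed.

Lemma loop_le (i : I) p : is_loop p ->
  - value (pullback (C := C i) tau) p <= L' * value (pullback (C := C i) l) p.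
Proof.
case/loop_pdart=> lq E; rewrite !E -value_opp.
by have := value_le_normL l_ge0 forestF mtau lq.
Qed.

Let M := (\sum_(i : I) \sum_(a in H1_2 (C i) | a != 0%R) 1)%N.

Lemma M_le : (M <= K)%N.
Proof.
rewrite /M /K; apply: (@leq_trans (\sum_(i : I) (2 ^ (2 * n - 1) - 1))).
  apply: leq_sum => i _; rewrite sum1_card.
  by have := count_classes hG.1 hrank hC i; rewrite cardsE.
by rewrite sum_nat_const leq_mul2r (count_covers hG.1 hrank hC) orbT.
Qed.

Lemma sum_M (x : R) : \sum_(i : I) \sum_(a in H1_2 (C i) | a != 0) x = M%:R * x.
Proof.
rewrite /M natr_sum mulr_suml; apply: eq_bigr => i _.
by rewrite natr_sum mulr_suml; apply: eq_bigr => a _; rewrite mul1r.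
Qed.

Lemma Nsum_le : 0 <= L' -> Nsum C l tau <= M%:R * L'.
Proof.
move=> L0; rewrite /Nsum -sum_M -sumrN; apply: ler_sum => i _.
rewrite -sumrN; apply: ler_sum => a _; rewrite lerNl.
by apply: term_ge => // [e|p]; [exact: l_ge0 | exact: loop_le].
Qed.

(** All terms of [N] are at least [- L'], so each of them is bounded by the
    sum. *)
Lemma Nsum_opp_ge (i : I) a : 0 <= L' -> a \in H1_2 (C i) -> a != 0 ->
  L' - T mtau a <= Nsum C l mtau + M%:R * L'.
Proof.
move=> L0 aH a0; rewrite /Nsum -sum_M [X in _ <= X]addrC -sumrB.
have nn j b : 0 <= L' - T (i := j) mtau b.
  rewrite subr_ge0; apply: term_le => // [e|p lp]; first exact: l_ge0.
  by have := loop_le lp; rewrite -value_opp.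
rewrite (bigD1 i) //= -sumrB (bigD1 a) /=; last by rewrite aH.
rewrite -addrA lerDl addr_ge0 //; apply: sumr_ge0 => j _; first exact: nn.
by rewrite -sumrB; apply: sumr_ge0 => b _; apply: nn.
Qed.

Let c := Nsum C l mtau + M%:R * L'.

Lemma c_ge0 : 0 <= L' -> 0 <= c.
Proof.
move=> L0; rewrite /c /Nsum -sum_M addrC -sumrB; apply: sumr_ge0 => i _.
rewrite -sumrB; apply: sumr_ge0 => a _; rewrite subr_ge0.
apply: term_le => // [e|p lp]; first exact: l_ge0.
by have := loop_le lp; rewrite -value_opp.
Qed.

Lemma csum_tau' w : cycle (hturn F) w ->
  csum (seg F tau') w = csum (seg F tau) w + L' * \sum_(d <- w) l d.1.
Proof.
move=> cyc; rewrite -(csum_seg_len cyc) -csum_lin.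
by congr (csum _ _); apply/funext => x; apply/funext => y; rewrite seg_lin.
Qed.

Lemma csum_mtau w : csum (seg F mtau) w = - csum (seg F tau) w.
Proof.
rewrite -mulN1r -csum_scale; congr (csum _ _); apply/funext => x; apply/funext => y.
by rewrite /seg /mtau sumrN mulN1r opprD.
Qed.

(** Up to the sign, the class of the lift contributes exactly the ratio of [tau]
    and [l] on [w] to the correction for [- tau]. *)
Lemma good_word_le w : 0 <= L' -> w <> [::] -> cycle (hturn F) w ->
  (forall v, (count (fun d => cc F (org d) == v) w <= 2)%N) ->
  csum (seg F tau') w <= c * \sum_(d <- w) l d.1.
Proof.
move=> L0 w0 cyc twice.
have [i [a [m [m0 aH a0 len val]]]] := good_class hG.1 hC l_ge0 forestF w0 cyc twice.
have := Nsum_opp_ge L0 aH a0; rewrite -/c /T len (val mtau) csum_mtau.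
have [x xw] : exists x : dart G, x \in w.
  by case: (w) w0 => // x t _; exists x; rewrite mem_head.
have len0 : 0 < \sum_(d <- w) l d.1.
  rewrite (big_rem x) //= ltr_pwDl ?sumr_ge0 // => [|d _]; last exact: l_ge0.
  rewrite lt_neqAle l_ge0 eq_sym andbT.
  by have := next_cycle cyc xw => /and4P[].
rewrite -mulf_div divff ?gt_eqF // mul1r mulNr opprK csum_tau' //.
by rewrite -ler_pdivrMr // => h; rewrite mulrDl mulfK ?gt_eqF // addrC.
Qed.

(** Nonnegative weights on the turns are what the covering needs. They come from
    [tau'], which is nonnegative on all loops, by adding a potential, and this
    leaves the values of cyclic words unchanged. *)
Lemma normL_le_corrected : 0 <= L' /\ normL l tau <= 3 * c - L'.
Proof.
have cyc0 q : cycle turn q -> 0 <= \sum_(d <- q) tau' (d : dart G).1.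
  exact: tau'_ge0.
have [pi pot] := exists_potential cyc0.
have L0 := L'_ge0 pot; split=> //.
apply: (normL_le l_ge0 forestF exists_tight) => q tq q0.
have [x xq px] := tight_pos forestF tq q0.
have [s [_ cyc E]] := @collapse_tight R G F forestF q x tq xq px.
have bound : csum (seg F tau') (x :: s) <= 3 * c * \sum_(d <- x :: s) l d.1.
  rewrite -(csum_potential (seg F tau') pi).
  apply: (@thrice_le R _ _ (@flip G) (fun d => cc F (org d)) (pos F) (hturn F)) cyc => //.
  - exact: flipK.
  - by move=> d; exact: flip_neq.
  - by move=> d d'; rewrite /hturn org_flip.
  - exact: seg_potential pot.
  - by move=> d; exact: l_ge0.
  - exact: c_ge0.
  - by move=> w w0 cycw twice; rewrite csum_potential; exact: good_word_le.
rewrite !E csum_seg_len // mulrBl lerBrDr.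
by rewrite csum_tau' in bound.
Qed.

Lemma final_bound :
  normN C K l tau <= (3 * (K + 1))%N%:R * normN C K l (fun e => - tau e).
Proof.
have [L0 Lle] := normL_le_corrected; have Nle := Nsum_le L0.
have MK : M%:R <= K%:R :> R by rewrite ler_nat M_le.
rewrite /normN -/mtau -/L' natrM natrD.
have K0 : (0 : R) <= K%:R by rewrite ler0n.
set k : R := K%:R in MK K0 *; rewrite -[K.+1%:R]natr1 -/k.
have k1 : 0 < k + 1 by lra.
have h1 : (k + 1)^-1 * Nsum C l tau <= L'.
  rewrite ler_pdivrMl //; apply: (le_trans Nle); apply: ler_wpM2r => //; lra.
have h2 : M%:R * L' <= k * L' by apply: ler_wpM2r.
rewrite mulrDr -[X in _ <= _ + X]mulrA [_ * (_^-1 * _)]mulrA mulfV ?gt_eqF // mul1r.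
by move: Lle h1 h2; rewrite /c; lra.
Qed.

End Final.

Theorem corollary15 (R : realType) (G : complex1) (n : nat)
    (hG : is_graph G) (hrank : graph_rank G = n) (hn : (2 <= n)%N)
    (I : finType) (C : I -> double_cover G) (hC : all_double_covers C)
    (l tau : edge G -> R) (hl : is_metric l) (htau : is_tangent tau) :
  let K := ((2 ^ n - 1) * (2 ^ (2 * n - 1) - 1))%N in
  let A : R := (3 * (K + 1))%N%:R in
  normN C K l tau <= A * normN C K l (fun e => - tau e).
Proof. by cbv zeta; exact: final_bound. Qed.
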